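(* Consider the finite group presentations \[ \begin{aligned} \mathcal X=\langle\, x,y,a,b,c,d,\tau,\sigma \mid\;& x^2yx^{-1}y,\; xy^4xy^{-1},\; [a,c],\,[a,d],\,[b,c],\,[b,d],\\ &\tau^{-1}x[a,b]\tau[c,d]^{-1},\; \sigma^{-1}y[a,b]\sigma[a,b]^{-2}\,\rangle , \end{aligned} \] $\mathcal Y$, obtained from $\mathcal X$ by adjoining the two further relators $\tau,\sigma$ (on the same eight generators), and $\mathcal Z$, obtained from $\mathcal Y$ by adjoining the four further relators $a,b,c,d$ (on the same eight generators). Let $K(\mathcal X)\subset K(\mathcal Y)\subset K(\mathcal Z)$ be the corresponding chain of standard two-dimensional presentation complexes. Then: (i) $K(\mathcal X)$ is non-aspherical; (ii) $K(\mathcal Y)$ is non-aspherical and Cockcroft; (iii) the inclusion-induced maps $\pi_2K(\mathcal X)\to\pi_2K(\mathcal Y)$ and $\pi_2K(\mathcal Y)\to\pi_2K(\mathcal Z)$ are both zero; (iv) the pair $(K(\mathcal Y),K(\mathcal X))$ has the identity property.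
   Context: For a group presentation $\mathcal P=\langle g_1,\dots,g_n\mid r_1,\dots,r_m\rangle$, the standard complex $K(\mathcal P)$ is the two-dimensional CW-complex with one $0$-cell, one oriented $1$-cell for each generator $g_j$, and one $2$-cell for each relator $r_i$, attached along the word $r_i$. Adding relators to a presentation (with the same generators) gives an inclusion of standard complexes. $[g,h]$ denotes the commutator $ghg^{-1}h^{-1}$. A connected two-dimensional CW-complex $K$ is aspherical if $\pi_2(K)=0$, and non-aspherical otherwise. It is Cockcroft if its Hurewicz homomorphism $\pi_2(K)\to H_2(K;\mathbb Z)$ is zero. Identity property. Let $\mathcal P=\langle \mathbf x\mid\mathbf r\rangle$, $\mathcal Q=\langle\mathbf x\mid\mathbf r,\mathbf s\rangle$, $X=K(\mathcal P)\subset Y=K(\mathcal Q)$, $F=F(\mathbf x)$ the free group on $\mathbf x$, and $H=\pi_1(Y)$. Let $\widetilde Y$ be the universal cover of $Y$. Its cellular chain group in dimension two is the free left $\mathbb Z[H]$-module $C_2(\widetilde Y)=\mathbb Z[H]\,\mathbf r\oplus\mathbb Z[H]\,\mathbf s$, and $\pi_2(Y)\cong H_2(\widetilde Y)=\ker\bigl(C_2(\widetilde Y)\to C_1(\widetilde Y)=\mathbb Z[H]\,\mathbf x\bigr)$, where the boundary map sends the basis element of a relator $\rho$ to $\sum_{g\in\mathbf x}\frac{\partial \rho}{\partial g}\,g$ (Fox derivatives, with coefficients mapped to $\mathbb Z[H]$). Let $j:\pi_2(Y)\to\mathbb Z[H]\,\mathbf s$ be the projection of a spherical cycle onto the coordinates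 of the new two-cells $\mathbf s$. The pair $(Y,X)$ has the identity property if and only if $j=0$; this may be taken as the definition. (Equivalently, in the language of pictures: in every spherical picture over $\mathcal Q$, after choosing transverse paths from the global basepoint to the $\mathbf s$-disks, where the $i$-th disk has label $s_i^{\varepsilon_i}$, $\varepsilon_i=\pm1$, and its path determines the word $\omega_i\in F$, the $\mathbf s$-disks can be paired $i\leftrightarrow j$ so that $s_i=s_j$, $\varepsilon_i=-\varepsilon_j$, and $\omega_i,\omega_j$ have the same image in $H$.) *)

(* Defs.v *)
From HB Require Import structures.
From mathcomp Require Import all_boot all_order all_algebra.
From mathcomp Require Import finmap boolp.
From mathcomp Require Import monalg.

Set Implicit Arguments.
Unset Strict Implicit.
Unset Printing Implicit Defensive.

Import GRing.Theory.

Local Open Scope ring_scope.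
Local Open Scope quotient_scope.

(* A letter [(x, true)] stands for the generator [x], [(x, false)] for its
   inverse.  Words are not required to be freely reduced. *)
Definition word (X : Type) : Type := seq (X * bool).

Section Words.
Variable X : Type.
Implicit Types u v : word X.

Definition gen (x : X) : word X := [:: (x, true)].
Definition linv (l : X * bool) : X * bool := (l.1, ~~ l.2).
Definition winv u : word X := rev (map linv u).

(* The convention is [u v u^-1 v^-1], not MathComp's [u^-1 v^-1 u v]. *)
Definition wcomm u v : word X := u ++ v ++ winv u ++ winv v.

Lemma linvK : involutive linv.
Proof. by case=> x e; rewrite /linv /= negbK. Qed.

Lemma winvK : involutive winv.
Proof.
move=> u; rewrite /winv map_rev revK -map_comp -[RHS]map_id.
by apply: eq_map => l /=; rewrite linvK.
Qed.

Lemma winv_cat u v : winv (u ++ v) = winv v ++ winv u.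
Proof. by rewrite /winv map_cat rev_cat. Qed.

Lemma winv_cons l u : winv (l :: u) = winv u ++ [:: linv l].
Proof. by rewrite /winv /= rev_cons cats1. Qed.

(* Two words are related when one is obtained from the other by finitely many
   insertions and deletions of words [l l^-1] and of relators; the classes form
   the quotient of the free group by the normal closure of [R]. *)
Inductive word_eq (R : word X -> Prop) : word X -> word X -> Prop :=
| word_eq_refl u : word_eq R u u
| word_eq_sym u v : word_eq R u v -> word_eq R v u
| word_eq_trans u v w : word_eq R u v -> word_eq R v w -> word_eq R u w
| word_eq_cancel u l v : word_eq R (u ++ l :: linv l :: v) (u ++ v)
| word_eq_rel u r v : R r -> word_eq R (u ++ r ++ v) (u ++ v).

Variable R : word X -> Prop.

Lemma word_eq_catl w u v : word_eq R u v -> word_eq R (w ++ u) (w ++ v).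
Proof.
elim=> {u v} [u|u v _ h|u v t _ h1 _ h2|u l v|u r v Rr].
- exact: word_eq_refl.
- exact: word_eq_sym.
- exact: word_eq_trans h1 h2.
- by rewrite !catA; apply: word_eq_cancel.
- by rewrite !(catA w); apply: word_eq_rel.
Qed.

Lemma word_eq_catr w u v : word_eq R u v -> word_eq R (u ++ w) (v ++ w).
Proof.
elim=> {u v} [u|u v _ h|u v t _ h1 _ h2|u l v|u r v Rr].
- exact: word_eq_refl.
- exact: word_eq_sym.
- exact: word_eq_trans h1 h2.
- by rewrite -!catA; apply: word_eq_cancel.
- by rewrite -!catA; apply: word_eq_rel.
Qed.

Lemma word_eq_cat u u' v v' :
  word_eq R u u' -> word_eq R v v' -> word_eq R (u ++ v) (u' ++ v').
Proof.
move=> hu hv; apply: word_eq_trans (word_eq_catl _ hv).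
exact: word_eq_catr.
Qed.

Lemma word_eq_mulwV u : word_eq R (u ++ winv u) [::].
Proof.
elim: u => [|l u ih]; first exact: word_eq_refl.
rewrite winv_cons -cat1s -catA (catA u).
apply: word_eq_trans (word_eq_cancel R [::] l [::]).
exact: (word_eq_catl [:: l] (word_eq_catr [:: linv l] ih)).
Qed.

Lemma word_eq_mulVw u : word_eq R (winv u ++ u) [::].
Proof. by have := word_eq_mulwV (winv u); rewrite winvK. Qed.

Lemma word_eq_winv u v : word_eq R u v -> word_eq R (winv u) (winv v).
Proof.
move=> huv.
have h1 : word_eq R (winv u) (winv u ++ (v ++ winv v)).
  have := word_eq_catl (winv u) (word_eq_sym (word_eq_mulwV v)).
  by rewrite cats0.
apply: word_eq_trans h1 _; rewrite catA.
apply: (word_eq_catr (winv v) (v := [::])).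
apply: word_eq_trans (word_eq_mulVw u).
by apply: word_eq_catl; apply: word_eq_sym.
Qed.

Lemma word_eq_sub (R' : word X -> Prop) u v :
  (forall w, R w -> R' w) -> word_eq R u v -> word_eq R' u v.
Proof.
move=> sRR'; elim=> {u v} [u|u v _ h|u v t _ h1 _ h2|u l v|u r v Rr].
- exact: word_eq_refl.
- exact: word_eq_sym.
- exact: word_eq_trans h1 h2.
- exact: word_eq_cancel.
- by apply: word_eq_rel; apply: sRR'.
Qed.

End Words.

Section PresentedGroup.
Variables (X : choiceType) (R : word X -> Prop).

Definition word_eqb (u v : word X) : bool := `[< word_eq R u v >].

Lemma word_eqb_equiv : equiv_class_of word_eqb.
Proof.
split.
- by move=> u; apply/asboolP; apply: word_eq_refl.
- move=> u v; apply/idP/idP => /asboolP h; apply/asboolP; exact: word_eq_sym.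
- move=> v u w /asboolP h1 /asboolP h2; apply/asboolP.
  exact: word_eq_trans h1 h2.
Qed.

Canonical word_equiv := EquivRelPack word_eqb_equiv.

(* The group with generators [X] and relators [R]. *)
Definition presgrp : Type := {eq_quot word_equiv}.
HB.instance Definition _ := Choice.on presgrp.

Definition cls (w : word X) : presgrp := \pi_({eq_quot word_equiv}) w.
Definition rep (a : presgrp) : word X := repr (a : {eq_quot word_equiv}).

Lemma repK a : cls (rep a) = a.
Proof. exact: (@reprK _ {eq_quot word_equiv}). Qed.

Lemma clsP u v : cls u = cls v <-> word_eq R u v.
Proof.
split; first by move/eqmodP/asboolP.
by move=> h; apply/eqmodP/asboolP.
Qed.

Lemma rep_cls w : word_eq R (rep (cls w)) w.
Proof. by apply/clsP; rewrite repK. Qed.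

Definition presgrp_mul (a b : presgrp) : presgrp := cls (rep a ++ rep b).
Definition presgrp_inv (a : presgrp) : presgrp := cls (winv (rep a)).

Lemma presgrp_mulE u v : presgrp_mul (cls u) (cls v) = cls (u ++ v).
Proof. by apply/clsP; apply: word_eq_cat; apply: rep_cls. Qed.

Lemma presgrp_invE u : presgrp_inv (cls u) = cls (winv u).
Proof. by apply/clsP; apply: word_eq_winv; apply: rep_cls. Qed.

Fact presgrp_mulA : associative presgrp_mul.
Proof.
move=> a b c; rewrite -(repK a) -(repK b) -(repK c).
by rewrite !presgrp_mulE catA.
Qed.

Fact presgrp_mul1 : left_id (cls [::]) presgrp_mul.
Proof. by move=> a; rewrite -(repK a) presgrp_mulE. Qed.

Fact presgrp_mulr1 : right_id (cls [::]) presgrp_mul.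
Proof. by move=> a; rewrite -(repK a) presgrp_mulE cats0. Qed.

Fact presgrp_mulV : left_inverse (cls [::]) presgrp_inv presgrp_mul.
Proof.
move=> a; rewrite -(repK a) presgrp_invE presgrp_mulE.
by apply/clsP; apply: word_eq_mulVw.
Qed.

Fact presgrp_mulrV : right_inverse (cls [::]) presgrp_inv presgrp_mul.
Proof.
move=> a; rewrite -(repK a) presgrp_invE presgrp_mulE.
by apply/clsP; apply: word_eq_mulwV.
Qed.

HB.instance Definition _ := isGroup.Build presgrp presgrp_mulA
  presgrp_mul1 presgrp_mulr1 presgrp_mulV presgrp_mulrV.

Lemma clsM u v : (cls u * cls v)%g = cls (u ++ v).
Proof. exact: presgrp_mulE. Qed.

Lemma clsV u : (cls u)^-1%g = cls (winv u).
Proof. exact: presgrp_invE. Qed.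

Lemma cls1 : cls [::] = 1%g.
Proof. by []. Qed.

End PresentedGroup.

Arguments cls {X} R w.

(* The homomorphism induced by the identity on generators; it is meaningful only
   when the relators [R] hold in the target. *)
Definition presgrp_map (X : choiceType) (R R' : word X -> Prop)
  (a : presgrp R) : presgrp R' := cls R' (rep a).

Section PresgrpMap.
Variables (X : choiceType) (R R' : word X -> Prop).
Hypothesis sRR' : forall w, R w -> R' w.

Lemma presgrp_map_cls w : presgrp_map R' (cls R w) = cls R' w.
Proof. by apply/clsP; apply: word_eq_sub (rep_cls _ _). Qed.

Lemma presgrp_map1 : presgrp_map R' (1%g : presgrp R) = 1%g.
Proof. exact: presgrp_map_cls. Qed.

Lemma presgrp_mapM (a b : presgrp R) :
  presgrp_map R' (a * b)%g = (presgrp_map R' a * presgrp_map R' b)%g.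
Proof. by rewrite -(repK a) -(repK b) clsM !presgrp_map_cls clsM. Qed.

End PresgrpMap.

Definition freegrp (X : choiceType) : groupType :=
  presgrp (fun _ : word X => False).

(* The integral group ring of a possibly infinite group.  The ring structure that
   [monalg] puts on [{malg int[K]}] is for monoids without units only, so only
   its additive structure is reused. *)
Definition grpring (G : groupType) : Type := {malg int[G]}.
HB.instance Definition _ (G : groupType) := GRing.Zmodule.on (grpring G).

Definition delta (G : groupType) (g : G) : grpring G := << g >>.

(* The additive extension of [f] to the free abelian group on [G]. *)
Definition zlift (G : groupType) (V : zmodType) (f : G -> V) (a : grpring G) :
  V := \sum_(g <- msupp a) f g *~ a@_g.

Section Zlift.
Variables (G : groupType) (V : zmodType).
Implicit Types (a b : grpring G) (f : G -> V).

Lemma zliftEw f a (D : {fset G}) : (msupp a `<=` D)%fset ->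
  zlift f a = \sum_(g <- D) f g *~ a@_g.
Proof.
move=> sD; rewrite /zlift (big_fset_incl _ sD) // => g _ ga.
by rewrite mcoeff_outdom.
Qed.

Fact zlift_is_zmod_morphism f : zmod_morphism (zlift f).
Proof.
move=> a b; pose D := (msupp a `|` msupp b)%fset.
have sab : (msupp (a - b : {malg int[G]}) `<=` D)%fset.
  apply/fsubsetP => g; rewrite -mcoeff_neq0 in_fsetU -!mcoeff_neq0.
  by rewrite mcoeffB; case: (eqVneq a@_g 0) => [->|//]; rewrite sub0r oppr_eq0.
rewrite (zliftEw f sab) (zliftEw f (fsubsetUl _ _ : (msupp a `<=` D)%fset)).
rewrite (zliftEw f (fsubsetUr _ _ : (msupp b `<=` D)%fset)) -sumrB.
by apply: eq_bigr => g _; rewrite mcoeffB mulrzBr.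
Qed.

HB.instance Definition _ f :=
  GRing.isZmodMorphism.Build (grpring G) V (zlift f) (zlift_is_zmod_morphism f).

Lemma zlift_delta f g : zlift f (delta g) = f g.
Proof.
rewrite (@zliftEw f (delta g) [fset g]%fset) ?msuppU_le //.
by rewrite big_seq_fset1 mcoeffUU.
Qed.

Lemma grpringE a : a = zlift (@delta G) a.
Proof.
rewrite {1}[a](monalgE (a : {malg int[G]})) /zlift; apply: eq_bigr => g _.
apply/(@malgP G int) => h; rewrite raddfMz /= !mcoeffU.
by case: eqP => _; rewrite ?mulr1n ?mulr0n ?mul0rz // intz.
Qed.

Lemma zlift_uniq (p q : {additive grpring G -> V}) :
  (forall g, p (delta g) = q (delta g)) -> p =1 q.
Proof.
move=> pq a; rewrite (grpringE a) /zlift !raddf_sum.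
by apply: eq_bigr => g _; rewrite !raddfMz pq.
Qed.

Lemma zliftD f1 f2 a : zlift (fun g => f1 g + f2 g) a = zlift f1 a + zlift f2 a.
Proof. by rewrite /zlift -big_split; apply: eq_bigr => g _; rewrite mulrzDl. Qed.

Lemma zliftN f a : zlift (fun g => - f g) a = - zlift f a.
Proof. by rewrite /zlift -sumrN; apply: eq_bigr => g _; rewrite mulNrz. Qed.

Lemma eq_zlift f1 f2 : f1 =1 f2 -> zlift f1 =1 zlift f2.
Proof. by move=> e a; apply: eq_bigr => g _; rewrite e. Qed.

End Zlift.

Section GroupRing.
Variable G : groupType.
Implicit Types a b c : grpring G.

Definition grpring_mul a b : grpring G :=
  zlift (fun g => zlift (fun h => delta (g * h)%g) b) a.

Definition grpring_rmul b a : grpring G := grpring_mul a b.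

Fact grpring_mull b : zmod_morphism (grpring_rmul b).
Proof. exact: raddfB. Qed.

Fact grpring_mulr a : zmod_morphism (grpring_mul a).
Proof.
move=> b c; rewrite /grpring_mul -zliftN -zliftD; apply: eq_zlift => g.
exact: raddfB.
Qed.

HB.instance Definition _ b :=
  GRing.isZmodMorphism.Build (grpring G) (grpring G) (grpring_rmul b)
    (grpring_mull b).
HB.instance Definition _ a :=
  GRing.isZmodMorphism.Build (grpring G) (grpring G) (grpring_mul a)
    (grpring_mulr a).

Lemma grpring_mulE g h : grpring_mul (delta g) (delta h) = delta (g * h)%g.
Proof. by rewrite /grpring_mul !zlift_delta. Qed.

Fact grpring_mulA : associative grpring_mul.
Proof.
move=> a b c.
apply: (zlift_uniq (p := grpring_rmul (grpring_mul b c))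
  (q := grpring_rmul c \o grpring_rmul b)) => g /=.
apply: (zlift_uniq (p := grpring_mul (delta g) \o grpring_rmul c)
  (q := grpring_rmul c \o grpring_mul (delta g))) => h /=.
apply: (zlift_uniq (p := grpring_mul (delta g) \o grpring_mul (delta h))
  (q := grpring_mul (grpring_mul (delta g) (delta h)))) => k /=.
by rewrite !grpring_mulE mulgA.
Qed.

Fact grpring_mul1 : left_id (delta 1%g) grpring_mul.
Proof.
apply: (zlift_uniq (p := grpring_mul (delta 1%g)) (q := idfun)) => g /=.
by rewrite grpring_mulE mul1g.
Qed.

Fact grpring_mulr1 : right_id (delta 1%g) grpring_mul.
Proof.
apply: (zlift_uniq (p := grpring_rmul (delta 1%g)) (q := idfun)) => g /=.
by rewrite /grpring_rmul grpring_mulE mulg1.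
Qed.

Fact grpring_mulDl : left_distributive grpring_mul +%R.
Proof. by move=> a b c; apply: (raddfD (grpring_rmul c)). Qed.

Fact grpring_mulDr : right_distributive grpring_mul +%R.
Proof. by move=> a b c; apply: (raddfD (grpring_mul a)). Qed.

Fact grpring_oner_neq0 : delta 1%g != 0 :> grpring G.
Proof.
apply/eqP => /(congr1 (zlift (fun=> 1%:Z))).
by rewrite zlift_delta raddf0.
Qed.

HB.instance Definition _ := GRing.Zmodule_isNzRing.Build (grpring G)
  grpring_mulA grpring_mul1 grpring_mulr1 grpring_mulDl grpring_mulDr
  grpring_oner_neq0.

Lemma deltaM (g h : G) : delta (g * h)%g = delta g * delta h.
Proof. by rewrite -grpring_mulE. Qed.

Lemma delta1 : delta (1%g : G) = 1.
Proof. by []. Qed.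

Definition aug : grpring G -> int := zlift (fun=> 1).
HB.instance Definition _ := GRing.Additive.on aug.

Fact aug_is_monoid_morphism : monoid_morphism aug.
Proof.
split=> [|a b]; first exact: zlift_delta.
apply: (zlift_uniq (p := aug \o grpring_rmul b)
  (q := aug b \o* @aug)) => g /=.
apply: (zlift_uniq (p := aug \o grpring_mul (delta g))
  (q := aug (delta g) \*o @aug)) => h /=.
by rewrite grpring_mulE /aug !zlift_delta.
Qed.

HB.instance Definition _ :=
  GRing.isMonoidMorphism.Build (grpring G) int aug aug_is_monoid_morphism.

Lemma aug_delta (g : G) : aug (delta g) = 1.
Proof. exact: zlift_delta. Qed.

End GroupRing.

Definition grpring_map (G H : groupType) (f : G -> H) : grpring G -> grpring H :=
  zlift (fun g => delta (f g)).

Section GroupRingMap.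
Variables (G H : groupType) (f : G -> H).

HB.instance Definition _ := GRing.Additive.on (grpring_map f).

Lemma grpring_map_delta g : grpring_map f (delta g) = delta (f g).
Proof. exact: zlift_delta. Qed.

Lemma grpring_mapM : (forall g h, f (g * h)%g = (f g * f h)%g) ->
  {morph grpring_map f : a b / a * b}.
Proof.
move=> fM a b.
apply: (zlift_uniq (p := grpring_map f \o grpring_rmul b)
  (q := grpring_rmul (grpring_map f b) \o grpring_map f)) => g /=.
apply: (zlift_uniq (p := grpring_map f \o grpring_mul (delta g))
  (q := grpring_mul (grpring_map f (delta g)) \o grpring_map f)) => h /=.
by rewrite grpring_mulE !grpring_map_delta fM grpring_mulE.
Qed.

Lemma aug_map a : aug (grpring_map f a) = aug a.
Proof.
apply: (zlift_uniq (p := @aug H \o grpring_map f) (q := @aug G)) => g /=.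
by rewrite grpring_map_delta !aug_delta.
Qed.

End GroupRingMap.

Section Fox.
Variable X : choiceType.

(* The derivation with [d(uv) = du + u dv] and [dx/dg = (x == g)], so that
   [d(x^-1)/dg = - (x == g) x^-1]. *)
Fixpoint fox (g : X) (w : word X) : grpring (freegrp X) :=
  if w is l :: w' then
    (if l.1 == g then (if l.2 then 1 else - delta (cls _ [:: l])) else 0)
      + delta (cls _ [:: l]) * fox g w'
  else 0.

Definition expsum (g : X) (w : word X) : int :=
  \sum_(l <- w | l.1 == g) (if l.2 then 1 else -1).

Lemma aug_fox g w : aug (fox g w) = expsum g w.
Proof.
rewrite /expsum; elim: w => [|[x e] w ih] /=; first by rewrite big_nil raddf0.
rewrite big_cons raddfD /= rmorphM /= aug_delta mul1r ih.
case: eqP => _; last by rewrite raddf0 add0r.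
by case: e; rewrite ?raddfN /= ?rmorph1 ?aug_delta.
Qed.

End Fox.

(* The relators form a finite family, possibly with repetitions: each index is a
   2-cell of the standard complex. *)
Record presentation (X : finType) := Presentation {
  relidx : finType;
  relator : relidx -> word X
}.

Arguments relator {X} p i.

Section StandardComplex.
Variable X : finType.
Implicit Type P : presentation X.

Definition is_relator P (w : word X) : Prop := exists i, w = relator P i.

(* The fundamental group of K(P). *)
Definition pi1 P : groupType := presgrp (is_relator P).

Definition toPi1 P : freegrp X -> pi1 P := presgrp_map (is_relator P).

(* The cellular chains in dimensions 2 and 1 of the universal cover of K(P), as
   coordinates in the free left Z[pi1 P]-modules on relators and generators. *)
Definition C2 P : zmodType := {ffun relidx P -> grpring (pi1 P)}.
Definition C1 P : zmodType := {ffun X -> grpring (pi1 P)}.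

Definition d2 P (c : C2 P) : C1 P :=
  [ffun g => \sum_i c i * grpring_map (toPi1 P) (fox g (relator P i))].

(* The cellular chains of K(P) itself; the boundary [K(P)]_2 -> [K(P)]_1 is given
   by the exponent sums of the attaching words. *)
Definition K2 P : zmodType := {ffun relidx P -> int}.
Definition K1 P : zmodType := {ffun X -> int}.

Definition dK P (c : K2 P) : K1 P :=
  [ffun g => \sum_i c i * expsum g (relator P i)].

Fact d2_is_zmod_morphism P : zmod_morphism (@d2 P).
Proof.
move=> c c'; apply/ffunP => g; rewrite !ffunE -sumrB.
by apply: eq_bigr => i _; rewrite !ffunE mulrBl.
Qed.

Fact dK_is_zmod_morphism P : zmod_morphism (@dK P).
Proof.
move=> c c'; apply/ffunP => g; rewrite !ffunE -sumrB.
by apply: eq_bigr => i _; rewrite !ffunE mulrBl.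
Qed.

HB.instance Definition _ P :=
  GRing.isZmodMorphism.Build (C2 P) (C1 P) (@d2 P) (@d2_is_zmod_morphism P).
HB.instance Definition _ P :=
  GRing.isZmodMorphism.Build (K2 P) (K1 P) (@dK P) (@dK_is_zmod_morphism P).

Definition is_cycle2 P : {pred C2 P} := [pred c | d2 c == 0].
Definition is_cycleK P : {pred K2 P} := [pred c | dK c == 0].

Fact is_cycle2_closed P : zmod_closed (@is_cycle2 P).
Proof.
split=> [|c c']; first by rewrite inE raddf0.
by rewrite !inE raddfB /= => /eqP-> /eqP->; rewrite subrr.
Qed.

Fact is_cycleK_closed P : zmod_closed (@is_cycleK P).
Proof.
split=> [|c c']; first by rewrite inE raddf0.
by rewrite !inE raddfB /= => /eqP-> /eqP->; rewrite subrr.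
Qed.

HB.instance Definition _ P :=
  GRing.isZmodClosed.Build (C2 P) (@is_cycle2 P) (@is_cycle2_closed P).
HB.instance Definition _ P :=
  GRing.isZmodClosed.Build (K2 P) (@is_cycleK P) (@is_cycleK_closed P).

(* The second homotopy group of K(P), as the second homology group of its
   universal cover; there are no 3-cells, so the homology group is the group of
   2-cycles. *)
Record pi2 P := Pi2 { spherical : C2 P; _ : spherical \in @is_cycle2 P }.
HB.instance Definition _ P := [isSub for @spherical P].
HB.instance Definition _ P := [Choice of pi2 P by <:].
HB.instance Definition _ P := [SubChoice_isSubZmodule of pi2 P by <:].

Record H2 P := HomK2 { cycleK : K2 P; _ : cycleK \in @is_cycleK P }.
HB.instance Definition _ P := [isSub for @cycleK P].
HB.instance Definition _ P := [Choice of H2 P by <:].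
HB.instance Definition _ P := [SubChoice_isSubZmodule of H2 P by <:].

(* The chain map of the universal covering projection. *)
Definition aug2 P (c : C2 P) : K2 P := [ffun i => aug (c i)].

Fact aug2_cycle P (z : pi2 P) : aug2 (spherical z) \in @is_cycleK P.
Proof.
case: z => c /= /[!inE] /eqP dc0; apply/eqP/ffunP => g.
have := congr1 (fun c' : C1 P => aug (c' g)) dc0.
rewrite !ffunE /= raddf0 raddf_sum => dcg0; rewrite -[RHS]dcg0; apply: eq_bigr => i _.
by rewrite /= rmorphM /= aug_map aug_fox !ffunE.
Qed.

(* The Hurewicz homomorphism: pi_2(K(P)) is H_2 of the universal cover, and the
   map to H_2(K(P)) is induced by the covering projection. *)
Definition hurewicz P (z : pi2 P) : H2 P := HomK2 (aug2_cycle z).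

Fact hurewicz_is_zmod_morphism P : zmod_morphism (@hurewicz P).
Proof.
move=> z z'; apply/val_inj/ffunP => i.
by rewrite !raddfB /= !ffunE raddfB.
Qed.

HB.instance Definition _ P :=
  GRing.isZmodMorphism.Build (pi2 P) (H2 P) (@hurewicz P)
    (@hurewicz_is_zmod_morphism P).

Definition aspherical P : Prop := forall z : pi2 P, z = 0.

Definition cockcroft P : Prop := forall z : pi2 P, hurewicz z = 0.

Definition adjoin P (s : seq (word X)) : presentation X :=
  @Presentation X (relidx P + 'I_(size s))%type
    (fun k => match k with inl i => relator P i | inr j => nth [::] s j end).

Section Adjoin.
Variables (P : presentation X) (s : seq (word X)).

Definition pi1_incl : pi1 P -> pi1 (adjoin P s) :=
  presgrp_map (is_relator (adjoin P s)).

Fact is_relator_adjoin w : is_relator P w -> is_relator (adjoin P s) w.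
Proof. by case=> i ->; exists (inl i). Qed.

Lemma pi1_incl_toPi1 g : pi1_incl (toPi1 P g) = toPi1 (adjoin P s) g.
Proof.
rewrite -(repK g) /pi1_incl /toPi1 !presgrp_map_cls //.
exact: is_relator_adjoin.
Qed.

(* The map on 2-chains of universal covers induced by the inclusion of K(P) in
   the standard complex of the enlarged presentation. *)
Definition incl2 (c : C2 P) : C2 (adjoin P s) :=
  [ffun k => match k with inl i => grpring_map pi1_incl (c i) | inr _ => 0 end].

Fact incl2_cycle (z : pi2 P) :
  incl2 (spherical z) \in @is_cycle2 (adjoin P s).
Proof.
case: z => c /= /[!inE] /eqP dc0; apply/eqP/ffunP => g.
have := congr1 (fun c' : C1 P => grpring_map pi1_incl (c' g)) dc0.
rewrite !ffunE /= raddf0 raddf_sum big_sumType /= => dcg0; rewrite -[RHS]dcg0.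
rewrite [X in _ + X]big1 ?addr0 => [|j _]; last by rewrite ffunE mul0r.
apply: eq_bigr => i _; rewrite ffunE grpring_mapM => [|a b]; last first.
  by apply: presgrp_mapM; apply: is_relator_adjoin.
congr (_ * _).
apply: (zlift_uniq (p := grpring_map (toPi1 (adjoin P s)))
  (q := grpring_map pi1_incl \o grpring_map (toPi1 P))) => h /=.
by rewrite !grpring_map_delta pi1_incl_toPi1.
Qed.

Definition pi2_incl (z : pi2 P) : pi2 (adjoin P s) := Pi2 (incl2_cycle z).

Fact pi2_incl_is_zmod_morphism : zmod_morphism pi2_incl.
Proof.
move=> z z'; apply/val_inj/ffunP => -[i|j]; rewrite !raddfB /= !ffunE.
  by rewrite raddfB.
by rewrite subrr.
Qed.

HB.instance Definition _ :=
  GRing.isZmodMorphism.Build (pi2 P) (pi2 (adjoin P s)) pi2_incl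
    pi2_incl_is_zmod_morphism.

Definition new_coords (z : pi2 (adjoin P s)) :
  {ffun 'I_(size s) -> grpring (pi1 (adjoin P s))} :=
  [ffun j => spherical z (inr j)].

(* The identity property of the pair (K(adjoin P s), K(P)). *)
Definition identity_property : Prop :=
  forall z : pi2 (adjoin P s), new_coords z = 0.

End Adjoin.

Definition presentation_of (s : seq (word X)) : presentation X :=
  @Presentation X 'I_(size s) (fun i => nth [::] s i).

End StandardComplex.

Definition gx   : word 'I_8 := gen (@Ordinal 8 0 isT).
Definition gy   : word 'I_8 := gen (@Ordinal 8 1 isT).
Definition ga   : word 'I_8 := gen (@Ordinal 8 2 isT).
Definition gb   : word 'I_8 := gen (@Ordinal 8 3 isT).
Definition gc   : word 'I_8 := gen (@Ordinal 8 4 isT).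
Definition gd   : word 'I_8 := gen (@Ordinal 8 5 isT).
Definition gtau : word 'I_8 := gen (@Ordinal 8 6 isT).
Definition gsig : word 'I_8 := gen (@Ordinal 8 7 isT).

Definition presX : presentation 'I_8 := presentation_of [::
  gx ++ gx ++ gy ++ winv gx ++ gy;
  gx ++ gy ++ gy ++ gy ++ gy ++ gx ++ winv gy;
  wcomm ga gc;
  wcomm ga gd;
  wcomm gb gc;
  wcomm gb gd;
  winv gtau ++ gx ++ wcomm ga gb ++ gtau ++ winv (wcomm gc gd);
  winv gsig ++ gy ++ wcomm ga gb ++ gsig
    ++ winv (wcomm ga gb) ++ winv (wcomm ga gb)].

Definition relsY : seq (word 'I_8) := [:: gtau; gsig].
Definition presY : presentation 'I_8 := adjoin presX relsY.

Definition relsZ : seq (word 'I_8) := [:: ga; gb; gc; gd].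
Definition presZ : presentation 'I_8 := adjoin presY relsZ.

(* Main.v *)
(** Over [pi_1] of [K(Y)] the letters [tau], [sigma] become trivial, so
    [y = [a,b]] and [x = [c,d][a,b]^-1] commute, whence [x = y = 1] and the group is
    free abelian on [a, b, c, d].  The Fox columns of [tau] and [sigma] then give
    the identity property, the columns of [x, y, a, b, c, d], differentiated at
    the identity, give the Cockcroft property, and a Koszul cycle on [[a,c]],
    [[a,d]], [[b,c]], [[b,d]] is a nonzero spherical class.  Since [pi_1] of [K(Z)] is
    trivial, the Cockcroft property also kills [pi_2 K(Y) -> pi_2 K(Z)].

    For [K(X)] one needs that [x[a,b]] and [y[a,b]] have infinite order, that [c]
    and [d] generate a free group, and that [x], [y] survive.  All of this is read
    off one permutation action in which [x] and [y] act through the alternating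
    group of degree five.  Infinite order makes the last two coordinates of a
    spherical cycle vanish, freeness the four before them, and the first two die
    in [K(Y)] because the exponent matrix of [x], [y] is unimodular.  A free
    identity among the first two relators gives a nonzero class. *)

Require Import Defs.
From HB Require Import structures.
From mathcomp Require Import all_boot all_order all_algebra.
From mathcomp Require Import boolp monalg ring zify.

Set Implicit Arguments.
Unset Strict Implicit.
Unset Printing Implicit Defensive.

Import Order.TTheory GRing.Theory Num.Theory.

Local Open Scope ring_scope.

(** Applying [p] kills the [b] term and turns the [a] term into [- x], so a functional can isolate
    one summand of a relation. *)
Lemma additive_sub1 (A : nzRingType) (V : zmodType) (p : {additive A -> V}) a b u v x :
  p (a * u) = p a + x -> p (b * v) = p b -> a * (1 - u) + b * (1 - v) = 0 -> x = 0.
Proof.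
move=> pau pbv; rewrite !mulrBr !mulr1 => /(congr1 p).
rewrite raddf0 raddfD !raddfB pau pbv subrr addr0 opprD addNKr => /eqP.
by rewrite oppr_eq0 => /eqP.
Qed.

(** * Functionals on group rings *)

Section GroupRingFunctionals.
Variable G : groupType.
Implicit Types (a b : grpring G) (g h u v : G).

Lemma delta_comm g h : (g * h = h * g)%g -> GRing.comm (delta g) (delta h).
Proof. by move=> gh; rewrite /GRing.comm -!deltaM gh. Qed.

Lemma zlift_mulr_delta (V : zmodType) (f : G -> V) a h :
  zlift f (a * delta h) = zlift (fun g => f (g * h)%g) a.
Proof.
apply: (zlift_uniq (p := zlift f \o grpring_rmul (delta h))
  (q := zlift (fun g => f (g * h)%g))) => g /=.
by rewrite /grpring_rmul grpring_mulE !zlift_delta.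
Qed.

Lemma zlift_eq_op g a : zlift (fun h => (h == g)%:R : int) a = (a : {malg int[G]})@_g.
Proof.
apply: (zlift_uniq (p := zlift (fun h => (h == g)%:R : int))
  (q := @mcoeff G int g)) => h /=.
by rewrite zlift_delta mcoeffU.
Qed.

(* [f] is a potential on the Cayley graph that jumps across a single edge: its
   translates read off the coefficients of [a]. *)
Lemma mul_sub1_eq0 u v (f : G -> int) a b :
    (forall h, f (h * u)%g = f h + (h == 1%g)%:R) ->
    (forall h, f (h * v)%g = f h) ->
  a * (1 - delta u) + b * (1 - delta v) = 0 -> a = 0.
Proof.
move=> fu fv ab0; apply/(@malgP G int) => g; rewrite mcoeff0 -zlift_eq_op.
pose fg h := f (g^-1 * h)%g.
apply: (additive_sub1 (p := zlift fg) _ _ ab0).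
  rewrite [LHS](zlift_mulr_delta fg a u) -[RHS]zliftD; apply: eq_zlift => h.
  by rewrite /fg mulgA fu -(inj_eq (mulgI g)) mulVKg mulg1.
rewrite [LHS](zlift_mulr_delta fg b v); apply: eq_zlift => h.
by rewrite /fg mulgA fv.
Qed.

(** The indicator of the positive powers of [u] jumps only from [1] to [u]; infinite order keeps [1]
    itself from being a positive power. *)
Lemma mul_delta_sub1_eq0 u a :
  (forall n, (u ^+ n.+1)%g != 1%g) -> a * (delta u - 1) = 0 -> a = 0.
Proof.
move=> u_inf au0.
pose f h : int := `[< exists n, h = (u ^+ n.+1)%g >]%:R.
apply: (@mul_sub1_eq0 u 1%g f a 0) => [h|h|]; rewrite ?mulg1 //; last first.
  by rewrite mul0r addr0 -[in LHS]opprB mulrN au0 oppr0.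
rewrite /f; case: (eqVneq h 1%g) => [->|h1] /=.
  rewrite mul1g (_ : `[< _ >] = true); last by apply/asboolP; exists 0%N; rewrite expg1.
  rewrite (_ : `[< _ >] = false) //; apply/asboolP => -[n /esym/eqP].
  exact/negP.
rewrite addr0; congr (_%:R); congr nat_of_bool; apply/asboolP/asboolP => -[n hE].
  case: n hE => [|n] hE.
    by case/eqP: h1; apply: (mulIg u); rewrite hE expg1 mul1g.
  by exists n; apply: (mulIg u); rewrite hE expgSr.
by exists n.+1; rewrite hE -expgSr.
Qed.

End GroupRingFunctionals.

(** * Actions of words and of presented groups *)

Section WordAction.
Variables (X : choiceType) (S : Type) (step : X * bool -> S -> S).
Implicit Types (u v w : word X) (p : S).

(** Letters apply from left to right, which gives a right action; hence the order of factors in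
    [pactM]. *)
Definition wact w p : S := foldl (fun q l => step l q) p w.

Lemma wact_cat u v p : wact (u ++ v) p = wact v (wact u p).
Proof. exact: foldl_cat. Qed.

Hypothesis stepK : forall l, cancel (step l) (step (linv l)).
Variable R : word X -> Prop.
Hypothesis relK : forall r p, R r -> wact r p = p.

Lemma wact_eq u v p : word_eq R u v -> wact u p = wact v p.
Proof.
move=> uv; elim: uv p => {u v} [//|u v _ h p|u v w _ h1 _ h2 p|u l v p|u r v Rr p].
- by rewrite h.
- by rewrite h1.
- by rewrite !wact_cat /= stepK.
- by rewrite !wact_cat (relK _ Rr).
Qed.

Definition pact (h : presgrp R) p : S := wact (rep h) p.

Lemma pact_cls w p : pact (cls R w) p = wact w p.
Proof. exact/wact_eq/rep_cls. Qed.

Lemma pactM (g h : presgrp R) p : pact (g * h)%g p = pact h (pact g p).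
Proof. by rewrite -(repK g) -(repK h) clsM !pact_cls wact_cat. Qed.

Lemma pact1 p : pact 1%g p = p.
Proof. by rewrite -cls1 pact_cls. Qed.

End WordAction.

(** * Fox calculus *)

Section FoxCalculus.
Variables (X : eqType) (R : word X -> Prop) (A : nzRingType) (e : word X -> A).
Hypothesis e_nil : e [::] = 1.
Hypothesis e_cat : forall u v, e (u ++ v) = e u * e v.
Hypothesis e_eq : forall u v, word_eq R u v -> e u = e v.
Implicit Types (u v w : word X) (g x : X).

(* The Fox derivative [dw/dg], pushed forward along the multiplicative map [e]. *)
Fixpoint efox g w : A :=
  if w is l :: w' then
    (if l.1 == g then (if l.2 then 1 else - e [:: l]) else 0) + e [:: l] * efox g w'
  else 0.

Lemma e_mulV u : e u * e (winv u) = 1.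
Proof. by rewrite -e_cat -e_nil; apply/e_eq/word_eq_mulwV. Qed.

Lemma e_Vmul u : e (winv u) * e u = 1.
Proof. by rewrite -e_cat -e_nil; apply/e_eq/word_eq_mulVw. Qed.

Lemma e_cat_winv u v : (e (u ++ winv v) == 1) = (e u == e v).
Proof.
rewrite e_cat; apply/eqP/eqP => [uv|->]; last exact: e_mulV.
by rewrite -[e u]mulr1 -(e_Vmul v) mulrA uv mul1r.
Qed.

Lemma e_wcomm u v : (e (wcomm u v) == 1) = (e u * e v == e v * e u).
Proof. by rewrite /wcomm catA -winv_cat e_cat_winv !e_cat. Qed.

Lemma e_wcomm1 u v : e u * e v = e v * e u -> e (wcomm u v) = 1.
Proof. by move=> uv; apply/eqP; rewrite e_wcomm uv. Qed.

Lemma efox_cat g u v : efox g (u ++ v) = efox g u + e u * efox g v.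
Proof.
elim: u => [|l u ih]; first by rewrite /= e_nil add0r mul1r.
by rewrite /= ih mulrDr addrA -[l :: u]cat1s e_cat mulrA.
Qed.

Lemma efox_gen g x : efox g (gen x) = (x == g)%:R.
Proof. by rewrite /= mulr0 addr0; case: eqP. Qed.

Lemma efox_winv g u : efox g (winv u) = - (e (winv u) * efox g u).
Proof.
elim: u => [|l u ih]; first by rewrite /= mulr0 oppr0.
have lV : efox g [:: linv l] = - (e [:: linv l] * efox g [:: l]).
  rewrite /= !mulr0 !addr0; case: eqP => _; last by rewrite mulr0 oppr0.
  case: l => x [] /=; rewrite ?mulr1 // mulrN opprK.
  exact/esym/(e_mulV (gen x)).
rewrite winv_cons -[l :: u]cat1s !efox_cat ih lV e_cat.
move: (efox g [:: l]) (efox g u) => dl du; rewrite mulrDr opprD addrC mulrN !mulrA.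
by rewrite -(mulrA _ (e [:: linv l]) (e [:: l])) (e_Vmul [:: l] : e [:: linv l] * _ = 1) mulr1.
Qed.

(** The prefix [u v u^-1] evaluates to [e v] and the whole commutator to [1], which leaves the
    boundary of a torus cell. *)
Lemma efox_wcomm g u v : e u * e v = e v * e u ->
  efox g (wcomm u v) = (1 - e v) * efox g u + (e u - 1) * efox g v.
Proof.
move=> uv.
have uvu : e u * e v * e (winv u) = e v by rewrite uv -mulrA e_mulV mulr1.
rewrite /wcomm !efox_cat !efox_winv !mulrDr !mulrN !mulrA uvu e_mulV mul1r.
by rewrite !mulrBl !mul1r (addrCA (e u * _)) !addrA.
Qed.

End FoxCalculus.

Arguments efox : simpl never.

Notation i8 k := (@Ordinal 8 k isT).

Lemma big_ord8 (V : nmodType) (F : 'I_8 -> V) :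
  \sum_i F i = F (i8 0) + (F (i8 1) + (F (i8 2) + (F (i8 3) + (F (i8 4) + (F (i8 5)
    + (F (i8 6) + F (i8 7))))))).
Proof.
rewrite !big_ord_recl big_ord0 addr0.
by repeat congr (_ + _); congr F; apply: val_inj.
Qed.

(** * Columns of the boundary matrix *)

Section Columns.
Variables (R : word 'I_8 -> Prop) (A : nzRingType) (e : word 'I_8 -> A).
Hypothesis e_nil : e [::] = 1.
Hypothesis e_cat : forall u v, e (u ++ v) = e u * e v.
Hypothesis e_eq : forall u v, word_eq R u v -> e u = e v.

(* The [g]-coordinate of the boundary of a 2-chain supported on the relators of
   [presX]; over [presY] the new cells contribute separately. *)
Definition colX (q : 'I_8 -> A) (g : 'I_8) : A :=
  \sum_i q i * efox e g (relator presX i).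

Lemma colXE q g : colX q g =
  q (i8 0) * efox e g (gx ++ gx ++ gy ++ winv gx ++ gy)
  + (q (i8 1) * efox e g (gx ++ gy ++ gy ++ gy ++ gy ++ gx ++ winv gy)
  + (q (i8 2) * efox e g (wcomm ga gc)
  + (q (i8 3) * efox e g (wcomm ga gd)
  + (q (i8 4) * efox e g (wcomm gb gc)
  + (q (i8 5) * efox e g (wcomm gb gd)
  + (q (i8 6) * efox e g
      (winv gtau ++ gx ++ wcomm ga gb ++ gtau ++ winv (wcomm gc gd))
  + q (i8 7) * efox e g
      (winv gsig ++ gy ++ wcomm ga gb ++ gsig
       ++ winv (wcomm ga gb) ++ winv (wcomm ga gb)))))))).
Proof. exact: big_ord8. Qed.

Let efoxE := (efox_cat e_nil e_cat, efox_winv e_nil e_cat e_eq, efox_gen).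
Let simp0 := (mulr0, mulr1, addr0, add0r, oppr0).

(** Only one relator contains [tau]; its two occurrences contribute [- tau^-1] and [tau^-1 x[a,b]].
    The case of [sigma] is parallel. *)
Lemma colX_tau q : colX q (i8 6) =
  q (i8 6) * (e (winv gtau) * (e gx * e (wcomm ga gb) - 1)).
Proof.
rewrite colXE !efoxE /= !simp0.
by rewrite mulrBr mulr1 [in LHS]addrC.
Qed.

Lemma colX_sig q : colX q (i8 7) =
  q (i8 7) * (e (winv gsig) * (e gy * e (wcomm ga gb) - 1)).
Proof.
rewrite colXE !efoxE /= !simp0.
by rewrite mulrBr mulr1 [in LHS]addrC.
Qed.

Hypothesis ac : e ga * e gc = e gc * e ga.
Hypothesis ad : e ga * e gd = e gd * e ga.
Hypothesis bc : e gb * e gc = e gc * e gb.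
Hypothesis bd : e gb * e gd = e gd * e gb.

Let comm g u v := @efox_wcomm _ R A e e_nil e_cat e_eq g u v.
Let commE g := (comm g ac, comm g ad, comm g bc, comm g bd).

Section NoStableLetters.
Variable q : 'I_8 -> A.
Hypotheses (q6 : q (i8 6) = 0) (q7 : q (i8 7) = 0).

Lemma colX_a0 : colX q (i8 2) = q (i8 2) * (1 - e gc) + q (i8 3) * (1 - e gd).
Proof. by rewrite colXE !commE q6 q7 !mul0r !efoxE /= !simp0. Qed.

Lemma colX_b0 : colX q (i8 3) = q (i8 4) * (1 - e gc) + q (i8 5) * (1 - e gd).
Proof. by rewrite colXE !commE q6 q7 !mul0r !efoxE /= !simp0. Qed.

End NoStableLetters.

Section InY.
Hypothesis ab : e ga * e gb = e gb * e ga.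
Hypothesis cd : e gc * e gd = e gd * e gc.
Hypotheses (x1 : e gx = 1) (y1 : e gy = 1) (tau1 : e gtau = 1) (sig1 : e gsig = 1).
Variable q : 'I_8 -> A.

Let w1 w : e w = 1 -> e (winv w) = 1.
Proof. by move=> ew; rewrite -(e_mulV e_nil e_cat e_eq w) ew mul1r. Qed.

Let gen1 := (x1, y1, tau1, sig1, w1 x1, w1 y1, w1 tau1, w1 sig1).
Let com1 := (e_wcomm1 e_nil e_cat e_eq ab, e_wcomm1 e_nil e_cat e_eq cd,
  w1 (e_wcomm1 e_nil e_cat e_eq ab), w1 (e_wcomm1 e_nil e_cat e_eq cd)).

Let colY g := (commE g, comm g ab, comm g cd, efoxE).

(** With [x], [y], [tau], [sigma] and the commutators evaluated to [1], the coefficients are the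
    exponent sums of [x] in the relators. *)
Lemma colY_x : colX q (i8 0) = q (i8 0) + q (i8 1) * 2 + q (i8 6).
Proof.
rewrite colXE !colY !gen1 !com1 /= !simp0 !mul1r subrr !simp0.
by rewrite addrA.
Qed.

Lemma colY_y : colX q (i8 1) = q (i8 0) * 2 + q (i8 1) * 3 + q (i8 7).
Proof.
rewrite colXE !colY !gen1 !com1 /= !simp0 !mul1r subrr !simp0.
by rewrite addrA.
Qed.

(** [[a,b]] has exponent [1] in the relator with [tau] and total exponent [1 - 2] in the one with
    [sigma]; hence the difference of the last two coordinates. *)
Lemma colY_a : colX q (i8 2) =
  q (i8 2) * (1 - e gc) + q (i8 3) * (1 - e gd) + (q (i8 6) - q (i8 7)) * (1 - e gb).
Proof.
rewrite colXE !colY !gen1 !com1 /= !simp0 !mul1r.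
by rewrite (addrA (1 - e gb)) subrr sub0r mulrN mulrBl !addrA.
Qed.

Lemma colY_b : colX q (i8 3) =
  q (i8 4) * (1 - e gc) + q (i8 5) * (1 - e gd) + (q (i8 6) - q (i8 7)) * (e ga - 1).
Proof.
rewrite colXE !colY !gen1 !com1 /= !simp0 !mul1r.
by rewrite (addrA (e ga - 1)) subrr sub0r mulrN mulrBl !addrA.
Qed.

Lemma colY_c : colX q (i8 4) =
  q (i8 2) * (e ga - 1) + q (i8 4) * (e gb - 1) + q (i8 6) * (e gd - 1).
Proof.
rewrite colXE !colY !gen1 !com1 /= !simp0 !mul1r.
by rewrite opprB addrA.
Qed.

Lemma colY_d : colX q (i8 5) =
  q (i8 3) * (e ga - 1) + q (i8 5) * (e gb - 1) + q (i8 6) * (1 - e gc).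
Proof.
rewrite colXE !colY !gen1 !com1 /= !simp0 !mul1r.
by rewrite opprB addrA.
Qed.

Lemma colY_tau : colX q (i8 6) = 0.
Proof. by rewrite colX_tau !gen1 !com1 !mul1r subrr mulr0. Qed.

Lemma colY_sig : colX q (i8 7) = 0.
Proof. by rewrite colX_sig !gen1 !com1 !mul1r subrr mulr0. Qed.

End InY.

End Columns.

(** * The complexes of [presY] and [presZ] *)

Section GroupY.
Local Open Scope group_scope.
Variable H : groupType.
Implicit Types x y a b c d k l u : H.

Lemma mulg_eqV u k : u * k^-1 = 1 -> u = k.
Proof. by move=> uk; rewrite -[u](mulgVK k) uk mul1g. Qed.

Lemma mulgV_comm a c : a * c * a^-1 * c^-1 = 1 -> commute a c.
Proof. by move/mulg_eqV => ac; rewrite /commute -{2}ac mulgVK. Qed.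

Lemma commute_comm u a b : commute u a -> commute u b ->
  commute u (a * b * a^-1 * b^-1).
Proof.
by move=> ua ub; exact: commuteM (commuteM (commuteM ua ub) (commuteV ua)) (commuteV ub).
Qed.

(* Adjoining [tau] and [sigma] gives [y = [a,b]] and [x = [c,d][a,b]^-1], so [x]
   and [y] commute, and the first two relators form a unimodular system. *)
Lemma relations_Y x y a b c d :
    let k := a * b * a^-1 * b^-1 in let l := c * d * c^-1 * d^-1 in
    x * x * y * x^-1 * y = 1 -> x * y * y * y * y * x * y^-1 = 1 ->
    commute a c -> commute a d -> commute b c -> commute b d ->
    x * k * l^-1 = 1 -> y * k * k^-1 * k^-1 = 1 ->
  [/\ x = 1, y = 1, commute a b & commute c d].
Proof.
move=> k l r1 r2 ac ad bc bd r6 r7.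
have yk : y = k by apply: mulg_eqV; rewrite -[RHS]r7 mulgK.
have xl : x = l * k^-1 by rewrite -(mulg_eqV r6) mulgK.
(* [k] is built from [a], [b] and [l] from [c], [d], and each of the former commutes with each of
   the latter. *)
have kl : commute l k.
  by apply: commute_comm; apply/commute_sym; apply: commute_comm.
have xy : commute x y.
  rewrite xl yk; apply/commute_sym/commuteM; first exact: commute_sym.
  exact: commuteV (commute_refl k).
have xyy : x * y * y = 1.
  by rewrite -(mulgA x x y) xy mulgA mulgK in r1.
(* The second relator is [(x y y) (y y x) y^-1], and both brackets are trivial. *)
have y1 : y = 1.
  have yx : y * y * x = 1 by rewrite -mulgA -xy mulgA -xy.
  rewrite xyy mul1g yx mul1g in r2.
  by rewrite -[y]invgK r2 invg1.
have k1 : k = 1 by rewrite -yk.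
have x1 : x = 1 by move: xyy; rewrite y1 !mulg1.
split=> //; first exact: mulgV_comm.
by apply: mulgV_comm; rewrite -/l -[LHS](mulgVK k) -xl x1 mul1g.
Qed.

End GroupY.

Section FoxInPi1.
Variables (X : finType) (P : presentation X).
Implicit Types (u v w : word X) (g : X).

Definition gcl w : pi1 P := cls (is_relator P) w.
Definition wdelta w : grpring (pi1 P) := delta (gcl w).

Lemma gcl_nil : gcl [::] = 1%g.
Proof. by []. Qed.

Lemma gcl_cat u v : gcl (u ++ v) = (gcl u * gcl v)%g.
Proof. by rewrite /gcl clsM. Qed.

Lemma gcl_winv u : gcl (winv u) = (gcl u)^-1%g.
Proof. by rewrite /gcl clsV. Qed.

Lemma gcl_wcomm u v :
  gcl (wcomm u v) = (gcl u * gcl v * (gcl u)^-1 * (gcl v)^-1)%g.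
Proof. by rewrite /wcomm !gcl_cat !gcl_winv !mulgA. Qed.

Lemma gcl_relator i : gcl (relator P i) = 1%g.
Proof.
rewrite -cls1; apply/clsP.
have Pr : is_relator P (relator P i) by exists i.
by have := word_eq_rel [::] [::] Pr; rewrite /= cats0.
Qed.

Lemma wdelta_nil : wdelta [::] = 1.
Proof. by []. Qed.

Lemma wdelta_cat u v : wdelta (u ++ v) = wdelta u * wdelta v.
Proof. by rewrite /wdelta gcl_cat deltaM. Qed.

Lemma wdelta_eq u v : word_eq (is_relator P) u v -> wdelta u = wdelta v.
Proof. by move=> uv; congr delta; apply/clsP. Qed.

(** The projection of group rings is multiplicative, so derivatives may be computed directly in the
    group ring of [pi1 P]. *)
Lemma grpring_map_fox g w : grpring_map (@toPi1 X P) (fox g w) = efox wdelta g w.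
Proof.
have deltaE u : grpring_map (@toPi1 X P) (delta (cls _ u)) = wdelta u.
  by rewrite grpring_map_delta; congr delta; apply: presgrp_map_cls.
elim: w => [|l w ih]; first exact: raddf0.
apply: etrans (raddfD (grpring_map (@toPi1 X P)) _ _) _; apply: congr2.
  case: (l.1 == g); last exact: raddf0.
  case: (l.2); first exact: deltaE [::].
  apply: etrans (raddfN (grpring_map (@toPi1 X P)) _) _.
  exact: congr1 _ (deltaE [:: l]).
apply: etrans (grpring_mapM _ _ _) _; first exact: presgrp_mapM.
exact: congr2 (deltaE [:: l]) ih.
Qed.

Lemma d2E (c : C2 P) g : d2 c g = \sum_i c i * efox wdelta g (relator P i).
Proof. by rewrite ffunE; apply: eq_bigr => i _; rewrite grpring_map_fox. Qed.

Lemma d2_pi2 (z : pi2 P) : d2 (spherical z) = 0.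
Proof. by case: z => c /= /eqP. Qed.

End FoxInPi1.

Arguments gcl {X} P w.
Arguments wdelta {X} P w.

Lemma d2_presY (c : C2 presY) g : d2 c g =
  colX (wdelta presY) (fun i => c (inl i)) g
  + (c (inr ord0) * (i8 6 == g)%:R + c (inr (lift ord0 ord0)) * (i8 7 == g)%:R).
Proof.
rewrite d2E big_sumType /=; congr (_ + _).
by rewrite big_ord_recl big_ord1 -!(efox_gen (wdelta presY)).
Qed.

Lemma presY_relations : [/\ gcl presY gx = 1%g, gcl presY gy = 1%g,
    gcl presY gtau = 1%g & gcl presY gsig = 1%g] /\
  [/\ commute (gcl presY ga) (gcl presY gb), commute (gcl presY gc) (gcl presY gd),
    commute (gcl presY ga) (gcl presY gc), commute (gcl presY ga) (gcl presY gd) &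
    commute (gcl presY gb) (gcl presY gc) /\ commute (gcl presY gb) (gcl presY gd)].
Proof.
have rel i : gcl presY (relator presX i) = 1%g by exact: (@gcl_relator _ presY (inl i)).
have t1 : gcl presY gtau = 1%g by exact: (@gcl_relator _ presY (inr ord0)).
have s1 : gcl presY gsig = 1%g by exact: (@gcl_relator _ presY (inr (lift ord0 ord0))).
have r0 : gcl presY (gx ++ gx ++ gy ++ winv gx ++ gy) = 1%g := rel (i8 0).
have r1 : gcl presY (gx ++ gy ++ gy ++ gy ++ gy ++ gx ++ winv gy) = 1%g := rel (i8 1).
have r2 : gcl presY (wcomm ga gc) = 1%g := rel (i8 2).
have r3 : gcl presY (wcomm ga gd) = 1%g := rel (i8 3).
have r4 : gcl presY (wcomm gb gc) = 1%g := rel (i8 4).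
have r5 : gcl presY (wcomm gb gd) = 1%g := rel (i8 5).
have r6 : gcl presY (winv gtau ++ gx ++ wcomm ga gb ++ gtau ++ winv (wcomm gc gd)) = 1%g
  := rel (i8 6).
have r7 : gcl presY (winv gsig ++ gy ++ wcomm ga gb ++ gsig
  ++ winv (wcomm ga gb) ++ winv (wcomm ga gb)) = 1%g := rel (i8 7).
rewrite gcl_wcomm in r2; rewrite gcl_wcomm in r3.
rewrite gcl_wcomm in r4; rewrite gcl_wcomm in r5.
rewrite !(gcl_wcomm, gcl_cat, gcl_winv) t1 invg1 !mul1g (mulgA (gcl presY gx)) in r6.
rewrite !(gcl_wcomm, gcl_cat, gcl_winv) s1 invg1 !mul1g in r7.
rewrite (mulgA (gcl presY gy)) (mulgA (_ * _))%g in r7.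
rewrite !(gcl_cat, gcl_winv) !mulgA in r0 r1.
have ac := mulgV_comm r2; have ad := mulgV_comm r3.
have bc := mulgV_comm r4; have bd := mulgV_comm r5.
by have [x1 y1 ab cd] := relations_Y r0 r1 ac ad bc bd r6 r7.
Qed.

Lemma expsum_cat (X : choiceType) (g : X) u v : expsum g (u ++ v) = expsum g u + expsum g v.
Proof. exact: big_cat. Qed.

Lemma expsum_word_eq (X : choiceType) (R : word X -> Prop) (g : X) u v :
  (forall r, R r -> expsum g r = 0) -> word_eq R u v -> expsum g u = expsum g v.
Proof.
move=> R0; elim=> {u v} [//|//|u v w _ -> //|u l v|u r v Rr].
  rewrite !expsum_cat /expsum !big_cons /=.
  by case: (l.1 == g) => //; case: (l.2) => /=; rewrite !addrA ?addrK ?subrK.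
by rewrite !expsum_cat (R0 _ Rr) add0r.
Qed.

(** * The identity property and the Cockcroft property of K(Y) *)

Section ExpsumDerivation.
Variables (X : finType) (P : presentation X) (g : X).
Hypothesis P0 : forall i, expsum g (relator P i) = 0.

(** Under [P0] the exponent sum descends to [pi1 P], and its additive extension is differentiation
    in the direction [g] at the identity. *)
Definition deg : grpring (pi1 P) -> int := zlift (fun h => expsum g (rep h)).
HB.instance Definition _ := GRing.Additive.on deg.

Lemma expsum_rep_gcl w : expsum g (rep (gcl P w)) = expsum g w.
Proof. by apply: expsum_word_eq (rep_cls _ _) => _ [i ->]. Qed.

Lemma deg_mul_wdelta a w : deg (a * wdelta P w) = deg a + aug a * expsum g w.
Proof.
rewrite [LHS]zlift_mulr_delta.
apply: (zlift_uniq (p := zlift (fun h => expsum g (rep (h * gcl P w)%g)))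
  (q := deg \+ expsum g w \o* @aug (pi1 P))) => h /=.
rewrite aug_delta mul1r /deg !zlift_delta -[h]repK -/(gcl P _) -gcl_cat !expsum_rep_gcl.
exact: expsum_cat.
Qed.

End ExpsumDerivation.

Section CockcroftY.
Variables (A : nzRingType) (e : word 'I_8 -> A) (R : word 'I_8 -> Prop).
Hypothesis e_nil : e [::] = 1.
Hypothesis e_cat : forall u v, e (u ++ v) = e u * e v.
Hypothesis e_eq : forall u v, word_eq R u v -> e u = e v.
Hypotheses (ac : e ga * e gc = e gc * e ga) (ad : e ga * e gd = e gd * e ga).
Hypotheses (bc : e gb * e gc = e gc * e gb) (bd : e gb * e gd = e gd * e gb).
Hypotheses (ab : e ga * e gb = e gb * e ga) (cd : e gc * e gd = e gd * e gc).
Hypotheses (x1 : e gx = 1) (y1 : e gy = 1) (tau1 : e gtau = 1) (sig1 : e gsig = 1).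

Variables (eps : {additive A -> int}) (p : 'I_8 -> {additive A -> int}).
Hypothesis p_der : forall (g x : 'I_8) a, (2 <= g < 6)%N ->
  p g (a * e (gen x)) = p g a + eps a * (x == g)%:R.

Let p_sub1 (g x : 'I_8) a : (2 <= g < 6)%N ->
  p g (a * (e (gen x) - 1)) = eps a * (x == g)%:R.
Proof. by move=> gP; rewrite mulrBr mulr1 raddfB p_der //= addrAC subrr add0r. Qed.

Let p_1sub (g x : 'I_8) a : (2 <= g < 6)%N ->
  p g (a * (1 - e (gen x))) = - (eps a * (x == g)%:R).
Proof. by move=> gP; rewrite -opprB mulrN raddfN /= p_sub1. Qed.

Variable q : 'I_8 -> A.
Hypothesis q_cycle : forall g : 'I_8, (g < 6)%N -> colX e q g = 0.

(** In a column whose entries are generators minus one, [p g] isolates the augmentation of the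
    coefficient belonging to [g]. The columns of [a], [b], [c] settle the coordinates from 2 on in
    this way. *)
Lemma aug_cycleY i : eps (q i) = 0.
Proof.
have ha := etrans (esym (colY_a e_nil e_cat e_eq ac ad bc bd ab cd x1 y1 tau1 sig1 q))
  (@q_cycle (i8 2) isT).
have hb := etrans (esym (colY_b e_nil e_cat e_eq ac ad bc bd ab cd x1 y1 tau1 sig1 q))
  (@q_cycle (i8 3) isT).
have hc := etrans (esym (colY_c e_nil e_cat e_eq ac ad bc bd ab cd x1 y1 tau1 sig1 q))
  (@q_cycle (i8 4) isT).
have hx := etrans (esym (colY_x e_nil e_cat e_eq ac ad bc bd ab cd x1 y1 tau1 sig1 q))
  (@q_cycle (i8 0) isT).
have hy := etrans (esym (colY_y e_nil e_cat e_eq ac ad bc bd ab cd x1 y1 tau1 sig1 q))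
  (@q_cycle (i8 1) isT).
have p3 g (a b c : A) : a + b + c = 0 -> p g a + p g b + p g c = 0.
  by move=> /(congr1 (p g)); rewrite !raddfD raddf0.
have simp := (p_sub1, p_1sub, mulr1, mulr0, oppr0, addr0, add0r).
have h2 : eps (q (i8 2)) = 0.
  by move: (p3 (i8 4) _ _ _ ha); rewrite !simp //= => /eqP; rewrite oppr_eq0 => /eqP.
have h3 : eps (q (i8 3)) = 0.
  by move: (p3 (i8 5) _ _ _ ha); rewrite !simp //= => /eqP; rewrite oppr_eq0 => /eqP.
(* The direction [b] yields only a difference; the column of [c] in the direction [d] gives [h6] and
   so separates the two. *)
have h67 : eps (q (i8 6) - q (i8 7)) = 0.
  by move: (p3 (i8 3) _ _ _ ha); rewrite !simp //= => /eqP; rewrite oppr_eq0 => /eqP.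
have h4 : eps (q (i8 4)) = 0.
  by move: (p3 (i8 4) _ _ _ hb); rewrite !simp //= => /eqP; rewrite oppr_eq0 => /eqP.
have h5 : eps (q (i8 5)) = 0.
  by move: (p3 (i8 5) _ _ _ hb); rewrite !simp //= => /eqP; rewrite oppr_eq0 => /eqP.
have h6 : eps (q (i8 6)) = 0.
  by move: (p3 (i8 5) _ _ _ hc); rewrite !simp.
have h7 : eps (q (i8 7)) = 0.
  by move: h67; rewrite raddfB h6 sub0r => /eqP; rewrite oppr_eq0 => /eqP.
have eps_nat a n : eps (a * n%:R) = eps a * n%:R by rewrite !mulr_natr raddfMn.
(* The remaining system for the first two coordinates has rows [(1, 2)] and [(2, 3)], of determinant
   [-1]. *)
move: (congr1 eps hx) (congr1 eps hy).
rewrite !raddfD !raddf0 !eps_nat h6 h7 !addr0 => e0 e1.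
have h1 : eps (q (i8 1)) = 0 by lia.
have h0 : eps (q (i8 0)) = 0 by lia.
by case: i => -[|[|[|[|[|[|[|[|k]]]]]]]] hk //; rewrite (bool_irrelevance hk isT).
Qed.

End CockcroftY.

(** The letters [a], [b], [c], [d] enter the relators only through commutators. *)
Lemma expsum_presY (g : 'I_8) i : (2 <= g < 6)%N -> expsum g (relator presY i) = 0.
Proof.
case: i => [[i hi]|[j hj]] /=; case: g => [[|[|[|[|[|[|g]]]]]] hg] // _;
  rewrite /expsum unlock; first [by do 8?[case: i hi => [|i] hi //]
    | by do 2?[case: j hj => [|j] hj //]].
Qed.

Lemma wdelta_presY : [/\ wdelta presY gx = 1, wdelta presY gy = 1,
    wdelta presY gtau = 1 & wdelta presY gsig = 1] /\
  let e := wdelta presY in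
  [/\ e ga * e gb = e gb * e ga, e gc * e gd = e gd * e gc,
    e ga * e gc = e gc * e ga, e ga * e gd = e gd * e ga &
    e gb * e gc = e gc * e gb /\ e gb * e gd = e gd * e gb].
Proof.
have [[x1 y1 t1 s1] [ab cd ac ad [bc bd]]] := presY_relations.
split; first by rewrite /wdelta x1 y1 t1 s1.
by split; [exact/delta_comm..|split; exact/delta_comm].
Qed.

Lemma add_mulb_eq0 (A : nzRingType) (s p0 p1 : A) (b : bool) :
  s = 0 -> s + (p0 * b%:R + p1 * (~~ b)%:R) = 0 -> (if b then p0 else p1) = 0.
Proof. by move=> ->; case: b; rewrite /= mulr1 mulr0 ?add0r ?addr0. Qed.

Lemma add_mul0_eq0 (A : nzRingType) (s p0 p1 : A) : s + (p0 * 0 + p1 * 0) = 0 -> s = 0.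
Proof. by rewrite !mulr0 !addr0. Qed.

Lemma ord2P (j : 'I_2) : j = ord0 \/ j = lift ord0 ord0.
Proof. by case: j => -[|[|k]] hj //; [left|right]; apply: val_inj. Qed.

Section CyclesY.
Let e := wdelta presY.
Variable z : pi2 presY.

Let colY g : colX e (fun i => spherical z (inl i)) g + (spherical z (inr ord0)
  * (i8 6 == g)%:R + spherical z (inr (lift ord0 ord0)) * (i8 7 == g)%:R) = 0.
Proof. by rewrite -d2_presY d2_pi2 ffunE. Qed.

(** In the columns of [tau] and [sigma] the old relators contribute multiples of [x[a,b] - 1] and
    [y[a,b] - 1], which vanish here; only the coordinate of the new cell is left. *)
Lemma spherical_presY_inr j : spherical z (inr j) = 0.
Proof.
have [[x1 y1 t1 s1] [ab _ _ _ _]] := wdelta_presY.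
have t0 := add_mulb_eq0 (colY_tau (@wdelta_nil _ presY) (@wdelta_cat _ presY)
  (@wdelta_eq _ presY) ab x1 t1 _) (colY (i8 6) : _ + (_ * true%:R + _ * false%:R) = 0).
have s0 := add_mulb_eq0 (colY_sig (@wdelta_nil _ presY) (@wdelta_cat _ presY)
  (@wdelta_eq _ presY) ab y1 s1 _) (colY (i8 7) : _ + (_ * false%:R + _ * true%:R) = 0).
by case: (ord2P j) => ->; [exact: t0|exact: s0].
Qed.

Lemma colX_spherical_presY (g : 'I_8) : (g < 6)%N ->
  colX e (fun i => spherical z (inl i)) g = 0.
Proof.
case: g => -[|[|[|[|[|[|g]]]]]] hg //= _;
by apply: (@add_mul0_eq0 _ _ (spherical z (inr ord0)) (spherical z (inr (lift ord0 ord0))));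
  exact: (colY (Ordinal hg)).
Qed.

Lemma aug_spherical_presY k : aug (spherical z k) = 0.
Proof.
have [[x1 y1 t1 s1] [ab cd ac ad [bc bd]]] := wdelta_presY.
case: k => [i|j]; last by rewrite spherical_presY_inr raddf0.
apply: (aug_cycleY (@wdelta_nil _ presY) (@wdelta_cat _ presY) (@wdelta_eq _ presY)
  ac ad bc bd ab cd x1 y1 t1 s1 (eps := @aug _) (p := fun g => @deg _ presY g)
  _ colX_spherical_presY) => g x a gP.
have expsum_gen : expsum g (gen x) = (x == g)%:R.
  by rewrite /expsum /gen big_cons big_nil /=; case: eqP.
rewrite -expsum_gen; exact: (deg_mul_wdelta (fun i => expsum_presY i gP)).
Qed.

End CyclesY.

Lemma identity_property_presY : identity_property presX relsY.
Proof. by move=> z; apply/ffunP => j; rewrite !ffunE spherical_presY_inr. Qed.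

Lemma cockcroft_presY : cockcroft presY.
Proof. by move=> z; apply/val_inj/ffunP => k; rewrite !ffunE /= aug_spherical_presY. Qed.

(** [x], [y], [tau], [sigma] die already over [presY], and the other four generators are the new
    relators. *)
Lemma gcl_presZ w : gcl presZ w = 1%g.
Proof.
have fromY u : gcl presY u = 1%g -> gcl presZ u = 1%g.
  rewrite -(gcl_nil presY) -(gcl_nil presZ) => /clsP uY; apply/clsP.
  by apply: word_eq_sub uY => r; apply: is_relator_adjoin.
have [[x1 y1 t1 s1] _] := presY_relations.
have gen1 x : gcl presZ (gen x) = 1%g.
  have new (j : 'I_4) := @gcl_relator _ presZ (inr j).
  case: x => -[|[|[|[|[|[|[|[|k]]]]]]]] hk //; rewrite (bool_irrelevance hk isT).
  - exact: fromY x1.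
  - exact: fromY y1.
  - exact: new ord0.
  - exact: new (lift ord0 ord0).
  - exact: new (lift ord0 (lift ord0 ord0)).
  - exact: new (lift ord0 (lift ord0 (lift ord0 ord0))).
  - exact: fromY t1.
  - exact: fromY s1.
elim: w => [|[x []] w ih]; first exact: gcl_nil.
  by rewrite -cat1s gcl_cat ih mulg1; exact: gen1.
rewrite -cat1s gcl_cat ih mulg1 -[[:: (x, false)]]/(winv (gen x)) gcl_winv.
by rewrite gen1 invg1.
Qed.

Lemma zlift_cst (G : groupType) (V : zmodType) (v : V) (a : grpring G) :
  zlift (fun=> v) a = v *~ aug a.
Proof.
rewrite /aug /zlift (big_morph (fun n => v *~ n) (mulrzDr v) (mulr0z v)).
by apply: eq_bigr => g _; rewrite intz.
Qed.

(** Over a trivial group the chain map sends each coordinate to its augmentation times the unit. *)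
Lemma pi2_incl_presZ (z : pi2 presY) : (pi2_incl relsZ z : pi2 presZ) = 0.
Proof.
apply/val_inj/ffunP => -[k|j]; rewrite !ffunE //.
transitivity (zlift (fun=> delta (1%g : pi1 presZ)) (spherical z k)).
  by apply: eq_zlift => h; rewrite -(repK (pi1_incl relsZ h)); congr delta; apply: gcl_presZ.
by rewrite zlift_cst aug_spherical_presY mulr0z.
Qed.

(** * A nonzero spherical class of K(Y) *)

Section KoszulCycle.
Variables (R : word 'I_8 -> Prop) (A : nzRingType) (e : word 'I_8 -> A).
Hypothesis e_nil : e [::] = 1.
Hypothesis e_cat : forall u v, e (u ++ v) = e u * e v.
Hypothesis e_eq : forall u v, word_eq R u v -> e u = e v.
Hypotheses (ac : e ga * e gc = e gc * e ga) (ad : e ga * e gd = e gd * e ga).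
Hypotheses (bc : e gb * e gc = e gc * e gb) (bd : e gb * e gd = e gd * e gb).
Hypotheses (ab : e ga * e gb = e gb * e ga) (cd : e gc * e gd = e gd * e gc).
Hypotheses (x1 : e gx = 1) (y1 : e gy = 1) (tau1 : e gtau = 1) (sig1 : e gsig = 1).

(** Up to sign, the product of the one-cycles [(1 - b) a + (a - 1) b] and [(1 - d) c + (c - 1) d],
    the Fox boundaries of [[a,b]] and [[c,d]]. *)
Definition koszul (i : 'I_8) : A :=
  nth 0 [:: 0; 0; (1 - e gd) * (e gb - 1); (e gc - 1) * (e gb - 1);
    (1 - e gd) * (1 - e ga); (e gc - 1) * (1 - e ga); 0; 0] i.

Let comm_sub (u v : A) : u * v = v * u -> (u - 1) * (v - 1) = (v - 1) * (u - 1).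
Proof.
by move=> uv; exact: commrB (commr_sym (commrB (esym uv) (commr1 v))) (commr1 _).
Qed.

Lemma koszul_cycle g : colX e koszul g = 0.
Proof.
have da := comm_sub ad; have db := comm_sub bd; have ca := comm_sub ac.
have cb := comm_sub bc; have dc := comm_sub cd; have ba := comm_sub ab.
have cases (Q : 'I_8 -> Prop) : Q (i8 0) -> Q (i8 1) -> Q (i8 2) -> Q (i8 3) ->
    Q (i8 4) -> Q (i8 5) -> Q (i8 6) -> Q (i8 7) -> Q g.
  by move=> *; case: g => -[|[|[|[|[|[|[|[|k]]]]]]]] hk //; rewrite (bool_irrelevance hk isT).
pattern g; apply: cases.
- by rewrite (colY_x e_nil e_cat e_eq) // /koszul /= mul0r !addr0.
- by rewrite (colY_y e_nil e_cat e_eq) // /koszul /= !mul0r !addr0.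
- rewrite (colY_a e_nil e_cat e_eq) // /koszul /= subrr mul0r addr0 -!(opprB _ 1).
  move: (e ga - 1) (e gb - 1) (e gc - 1) (e gd - 1) da db ca cb dc ba =>
    a b c d da db ca cb dc ba.
  by rewrite !(mulNr, mulrN) ?opprK  -db -(mulrA b) -dc mulrA cb subrr.
- rewrite (colY_b e_nil e_cat e_eq) // /koszul /= subrr mul0r addr0 -!(opprB _ 1).
  move: (e ga - 1) (e gb - 1) (e gc - 1) (e gd - 1) da db ca cb dc ba =>
    a b c d da db ca cb dc ba.
  by rewrite !(mulNr, mulrN) ?opprK  -da -(mulrA a) -dc mulrA ca addNr.
- rewrite (colY_c e_nil e_cat e_eq) // /koszul /= mul0r addr0 -!(opprB _ 1).
  move: (e ga - 1) (e gb - 1) (e gc - 1) (e gd - 1) da db ca cb dc ba =>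
    a b c d da db ca cb dc ba.
  by rewrite !(mulNr, mulrN) ?opprK  -!mulrA ba addNr.
- rewrite (colY_d e_nil e_cat e_eq) // /koszul /= mul0r addr0 -!(opprB _ 1).
  move: (e ga - 1) (e gb - 1) (e gc - 1) (e gd - 1) da db ca cb dc ba =>
    a b c d da db ca cb dc ba.
  by rewrite !(mulNr, mulrN) ?opprK -!mulrA ba subrr.
- by rewrite (colY_tau e_nil e_cat e_eq).
- by rewrite (colY_sig e_nil e_cat e_eq).
Qed.

End KoszulCycle.

Lemma expsum_nseq (X : choiceType) (x : X) m :
  expsum x (flatten (nseq m (gen x))) = m%:R.
Proof.
elim: m => [|m ih]; first exact: big_nil.
by rewrite /= -cat1s expsum_cat ih mulrS /expsum big_cons big_nil /= eqxx addr0.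
Qed.

Section GeneratorOrder.
Variables (X : finType) (P : presentation X) (g : X).
Hypothesis P0 : forall i, expsum g (relator P i) = 0.

Lemma expsum_rep1 : expsum g (rep (1%g : pi1 P)) = 0.
Proof. by have := expsum_rep_gcl P0 [::]; rewrite gcl_nil /expsum big_nil. Qed.

Lemma gcl_gen_infinite_order n : (gcl P (gen g) ^+ n.+1)%g != 1%g.
Proof.
have -> : (gcl P (gen g) ^+ n.+1)%g = gcl P (flatten (nseq n.+1 (gen g))).
  by elim: n.+1 => [//|m ih]; rewrite expgS ih -gcl_cat.
apply/eqP => /(congr1 (fun h => expsum g (rep h))).
by rewrite expsum_rep1 expsum_rep_gcl // expsum_nseq => /eqP; rewrite pnatr_eq0.
Qed.

Lemma wdelta_gen_neq1 : wdelta P (gen g) <> 1.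
Proof.
rewrite -(wdelta_nil P) => /(congr1 (zlift (fun h => expsum g (rep h)))).
by rewrite !zlift_delta !expsum_rep_gcl // /expsum big_nil /gen big_cons big_nil /= eqxx.
Qed.

End GeneratorOrder.

Lemma presY_not_aspherical : ~ aspherical presY.
Proof.
have [[x1 y1 t1 s1] [ab cd ac ad [bc bd]]] := wdelta_presY.
pose e := wdelta presY.
pose c : C2 presY := [ffun k => if k is inl i then koszul e i else 0].
have c_cycle : c \in @is_cycle2 _ presY.
  apply/eqP/ffunP => g; rewrite d2_presY ffunE !ffunE !mul0r !addr0.
  rewrite -[RHS](koszul_cycle (@wdelta_nil _ presY) (@wdelta_cat _ presY)
    (@wdelta_eq _ presY) ac ad bc bd ab cd x1 y1 t1 s1 g).
  by apply: eq_bigr => i _; apply: (congr2 _ (ffunE _ _)) (erefl _).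
(* The [[a,c]] coordinate is [(1 - d) (b - 1)]: the second factor can be cancelled since [b] has
   infinite order, and the first is nonzero. *)
move=> /(_ (Pi2 c_cycle)) /(congr1 (fun z : pi2 presY => (spherical z : C2 presY) (inl (i8 2)))).
rewrite /= ffunE [RHS]ffunE => db0.
have deg0 g := @expsum_presY g.
have b_inf n := gcl_gen_infinite_order (fun i => deg0 (i8 3) i isT) n.
have d1 : 1 - e gd = 0 := mul_delta_sub1_eq0 b_inf db0.
exact: wdelta_gen_neq1 (fun i => deg0 (i8 5) i isT) (esym (subr0_eq d1)).
Qed.

(** * The action of the group of [presX] *)

Section IntegerIteration.
Variables (T : Type) (f f' : T -> T).
Hypotheses (fK : cancel f f') (f'K : cancel f' f).

(** [Negz k] is [- (k + 1)], hence [k.+1] inverse steps. *)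
Definition ziter (h h' : T -> T) (n : int) (t : T) : T :=
  match n with Posz k => iter k h t | Negz k => iter k.+1 h' t end.

Lemma iterK (h h' : T -> T) n : cancel h h' -> cancel (iter n h) (iter n h').
Proof. by move=> hK t; elim: n => // n ih; rewrite iterSr /= hK. Qed.

Lemma ziterK n : cancel (ziter f f' n) (ziter f' f n).
Proof. by case: n => n t; rewrite /ziter; apply: iterK. Qed.

Lemma ziterSr n t : ziter f f' (n + 1) t = ziter f f' n (f t).
Proof.
case: n => [n|[|n]]; first by rewrite addrC /= -iterS iterSr.
  by rewrite /= fK.
have -> : Negz n.+1 + 1 = Negz n by rewrite !NegzE; lia.
by rewrite /ziter [RHS]iterSr fK.
Qed.

Lemma ziter_comm (g : T -> T) n t : (forall t, f (g t) = g (f t)) ->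
  ziter f f' n (g t) = g (ziter f f' n t).
Proof.
move=> fg; have f'g s : f' (g s) = g (f' s) by rewrite -{1}(f'K s) -fg fK.
have it h k : (forall s, h (g s) = g (h s)) -> iter k h (g t) = g (iter k h t).
  by move=> hg; elim: k => //= k ->.
by case: n => n; apply: it.
Qed.

End IntegerIteration.

Inductive five := Pt0 | Pt1 | Pt2 | Pt3 | Pt4.

(** [x5] is a 3-cycle and [y5] a 5-cycle, chosen so that their right action satisfies the first two
    relators. *)
Definition x5 i := match i with Pt0 => Pt0 | Pt1 => Pt1 | Pt2 => Pt3 | Pt3 => Pt4 | Pt4 => Pt2 end.
Definition x5V i := match i with Pt0 => Pt0 | Pt1 => Pt1 | Pt2 => Pt4 | Pt3 => Pt2 | Pt4 => Pt3 end.
Definition y5 i := match i with Pt0 => Pt2 | Pt1 => Pt3 | Pt2 => Pt1 | Pt3 => Pt4 | Pt4 => Pt0 end.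
Definition y5V i := match i with Pt0 => Pt4 | Pt1 => Pt2 | Pt2 => Pt0 | Pt3 => Pt1 | Pt4 => Pt3 end.

Lemma x5K : cancel x5 x5V. Proof. by case. Qed.
Lemma x5VK : cancel x5V x5. Proof. by case. Qed.
Lemma y5K : cancel y5 y5V. Proof. by case. Qed.
Lemma y5VK : cancel y5V y5. Proof. by case. Qed.

Section ActionX.
Variable K : archiRealFieldType.

Local Notation F2 := (freegrp bool).
Definition cF : F2 := cls _ (gen true).
Definition dF : F2 := cls _ (gen false).
Definition uF : F2 := (cF * dF * cF^-1 * dF^-1)%g.

Definition omega : Type := K * (F2 * five) * K.
Definition middle : Type := F2 * five.

(** [tw] after [x] is translation by [uF], the action of [[c,d]] on the free group; [sg] undoes
    [y]. *)
Definition tw (t : middle) : middle := ((t.1 * uF)%g, x5V t.2).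
Definition twV (t : middle) : middle := ((t.1 * uF^-1)%g, x5 t.2).
Definition sg (t : middle) : middle := (t.1, y5V t.2).
Definition sgV (t : middle) : middle := (t.1, y5 t.2).

Lemma twK : cancel tw twV.
Proof. by move=> [k i]; rewrite /tw /twV /= mulgK x5VK. Qed.
Lemma twVK : cancel twV tw.
Proof. by move=> [k i]; rewrite /tw /twV /= mulgVK x5K. Qed.
Lemma sgK : cancel sg sgV.
Proof. by move=> [k i]; rewrite /sg /sgV /= y5VK. Qed.
Lemma sgVK : cancel sgV sg.
Proof. by move=> [k i]; rewrite /sg /sgV /= y5K. Qed.

(* On the first coordinate [[a,b]] is [r |-> r + 1] and [sigma] doubles, so
   [[a,b]] is conjugate to its square; [[c,d]] is [s |-> s + 1] on the last
   coordinate, where [c] and [d] also act on the free group by translation, and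
   [tau] swaps the two outer coordinates.  The powers of [tw] and [sg] correct
   [tau] and [sigma] for the action of [x], [y] and of [[c,d]] on the middle
   coordinate. *)
Definition stepX (l : 'I_8 * bool) (p : omega) : omega :=
  let: (r, t, s) := p in
  match nat_of_ord l.1, l.2 with
  | 0%N, true => (r, (t.1, x5 t.2), s)
  | 0%N, false => (r, (t.1, x5V t.2), s)
  | 1%N, true => (r, (t.1, y5 t.2), s)
  | 1%N, false => (r, (t.1, y5V t.2), s)
  | 2%N, true => (r / 2, t, s)
  | 2%N, false => (r * 2, t, s)
  | 3%N, true => (r + 1, t, s)
  | 3%N, false => (r - 1, t, s)
  | 4%N, true => (r, ((t.1 * cF)%g, t.2), s / 2)
  | 4%N, false => (r, ((t.1 * cF^-1)%g, t.2), s * 2)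
  | 5%N, true => (r, ((t.1 * dF)%g, t.2), s + 1)
  | 5%N, false => (r, ((t.1 * dF^-1)%g, t.2), s - 1)
  | 6%N, true => (s, ziter tw twV (Num.floor r) t, r)
  | 6%N, false => (s, ziter twV tw (Num.floor s) t, r)
  | _, true => (r * 2, ziter sg sgV (Num.floor r) t, s)
  | _, false => (r / 2, ziter sgV sg (Num.floor (r / 2)) t, s)
  end.

Let half2 (r : K) : r / 2 * 2 = r. Proof. by rewrite mulfVK // pnatr_eq0. Qed.
Let twice2 (r : K) : r * 2 / 2 = r. Proof. by rewrite mulfK // pnatr_eq0. Qed.

Lemma stepXK l : cancel (stepX l) (stepX (linv l)).
Proof.
move=> [[r t] s]; case: l => -[m hm] e; rewrite /stepX /linv /=.
have zK f f' n : cancel f f' -> cancel f' f -> ziter f' f n (ziter f f' n t) = t :> middle.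
  by move=> h h'; apply: ziterK.
case: m hm => [|[|[|[|[|[|[|m]]]]]]] hm; case: e => /=;
  rewrite ?x5K ?x5VK ?y5K ?y5VK ?half2 ?twice2 ?addrK ?subrK ?mulgK ?mulgVK //;
  rewrite ?(zK _ _ _ twK twVK) ?(zK _ _ _ twVK twK) ?(zK _ _ _ sgK sgVK)
    ?(zK _ _ _ sgVK sgK) //; by case: t {zK}.
Qed.

Lemma wact_winvK w p : wact stepX (winv w) (wact stepX w p) = p.
Proof.
rewrite -wact_cat; exact: (wact_eq stepXK (R := fun=> False) _ _ (word_eq_mulwV _ w)).
Qed.

(** Reduces a conjugation relator to the equation [u t = t v] between actions. *)
Lemma wact_conj t u v p : (forall p, wact stepX (u ++ t) p = wact stepX (t ++ v) p) ->
  wact stepX (winv t ++ u ++ t ++ winv v) p = p.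
Proof.
move=> uv; rewrite (catA u) wact_cat wact_cat uv wact_cat wact_winvK.
by have := wact_winvK (winv t) p; rewrite winvK.
Qed.

Lemma wact_cat3 u v w p :
  wact stepX (u ++ v ++ w) p = wact stepX w (wact stepX v (wact stepX u p)).
Proof. by rewrite !wact_cat. Qed.

Lemma wact_ab r t s : wact stepX (wcomm ga gb) (r, t, s) = (r + 1, t, s).
Proof. by rewrite /=; congr (_, _, _); field. Qed.

Lemma wact_cd r t s : wact stepX (wcomm gc gd) (r, t, s) = (r, ((t.1 * uF)%g, t.2), s + 1).
Proof. by rewrite /= /uF !mulgA; congr (_, _, _); field. Qed.

Lemma wact_x r t s : wact stepX gx (r, t, s) = (r, (t.1, x5 t.2), s).
Proof. by []. Qed.

Lemma wact_y r t s : wact stepX gy (r, t, s) = (r, (t.1, y5 t.2), s).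
Proof. by []. Qed.

Lemma wact_tau r t s :
  wact stepX gtau (r, t, s) = (s, ziter tw twV (Num.floor r) t, r).
Proof. by []. Qed.

Lemma wact_sig r t s :
  wact stepX gsig (r, t, s) = (r * 2, ziter sg sgV (Num.floor r) t, s).
Proof. by []. Qed.

Lemma wact_xabtau p :
  wact stepX (gx ++ wcomm ga gb ++ gtau) p = wact stepX (gtau ++ wcomm gc gd) p.
Proof.
case: p => [[r t] s]; rewrite (wact_cat3 gx (wcomm ga gb) gtau).
rewrite (wact_cat stepX gtau (wcomm gc gd)).
rewrite wact_x wact_ab !wact_tau wact_cd.
(* Passing from [r] to [r + 1] adds one power of [tw], which cancels [x] and translates by [uF]. *)
rewrite floorDrz ?int_num1 // floor1 (ziterSr twK) /tw /= x5K.
(* Translation by [uF] commutes with [tw], so it moves out of the iteration. *)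
have := @ziter_comm _ tw twV twK twVK (fun t => ((t.1 * uF)%g, t.2)) (Num.floor r) t.
by move=> ->.
Qed.

Lemma wact_yabsig p :
  wact stepX (gy ++ wcomm ga gb ++ gsig) p =
  wact stepX (gsig ++ wcomm ga gb ++ wcomm ga gb) p.
Proof.
case: p => [[r t] s]; rewrite (wact_cat3 gy (wcomm ga gb) gsig).
rewrite (wact_cat3 gsig (wcomm ga gb) (wcomm ga gb)).
rewrite wact_y wact_ab !wact_sig !wact_ab.
(* The extra power of [sg] cancels [y]; on the first coordinate [2 (r + 1) = 2 r + 1 + 1]. *)
rewrite floorDrz ?int_num1 // floor1 (ziterSr sgK) {2}/sg /= y5K.
case: t => t1 t2 /=; congr (_, _, _). by field.
Qed.

Lemma wact_presX r p : is_relator presX r -> wact stepX r p = p.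
Proof.
case=> -[i hi] ->.
case: i hi => [|[|[|[|[|[|[|[|i]]]]]]]] hi //.
(* The first two relators are checked at each of the five points. *)
- by case: p => [[r' [k []]] s].
- by case: p => [[r' [k []]] s].
- by case: p => [[r' [k j]] s] /=; rewrite ?mulgK ?half2.
- by case: p => [[r' [k j]] s] /=; rewrite ?mulgK ?half2 ?addrK.
- by case: p => [[r' [k j]] s] /=; rewrite ?mulgK ?half2 ?addrK.
- by case: p => [[r' [k j]] s] /=; rewrite ?mulgK ?half2 ?addrK.
- exact: (wact_conj (u := gx ++ wcomm ga gb) _ wact_xabtau).
exact: (wact_conj (u := gy ++ wcomm ga gb) (v := wcomm ga gb ++ wcomm ga gb) _ wact_yabsig).
Qed.

Let piX := pi1 presX.
Definition actX (h : piX) (p : omega) : omega := pact stepX h p.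

Lemma actX_gcl w p : actX (gcl presX w) p = wact stepX w p.
Proof. exact: (pact_cls stepXK wact_presX). Qed.

Lemma actXM g h p : actX (g * h)%g p = actX h (actX g p).
Proof. exact: (pactM stepXK wact_presX). Qed.

Lemma actX1 p : actX 1%g p = p.
Proof. exact: (pact1 stepXK wact_presX). Qed.

(** The first coordinate of the orbit of a point over [0] counts the powers of [h]. *)
Lemma translation_infinite_order (h : piX) n :
  (forall r t s, exists t', actX h (r, t, s) = (r + 1, t', s)) -> (h ^+ n.+1)%g != 1%g.
Proof.
move=> hP; apply/eqP => /(congr1 (fun g => (actX g (0, (1%g, Pt0), 0)).1.1)).
rewrite actX1 /=.
have hn m t : exists t', actX (h ^+ m)%g (0, t, 0) = (m%:R, t', 0).
  elim: m => [|m [t' ih]]; first by exists t; rewrite expg0 actX1.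
  by have [t2 E] := hP m%:R t' 0; exists t2; rewrite expgSr actXM ih E -natr1.
have [t' ->] := hn n.+1 (1%g, Pt0).
by move/eqP; rewrite pnatr_eq0.
Qed.

Lemma xab_infinite_order n : (gcl presX (gx ++ wcomm ga gb) ^+ n.+1)%g != 1%g.
Proof.
apply: translation_infinite_order => r t s; exists (t.1, x5 t.2).
by rewrite actX_gcl wact_cat wact_x wact_ab.
Qed.

Lemma yab_infinite_order n : (gcl presX (gy ++ wcomm ga gb) ^+ n.+1)%g != 1%g.
Proof.
apply: translation_infinite_order => r t s; exists (t.1, y5 t.2).
by rewrite actX_gcl wact_cat wact_y wact_ab.
Qed.

(** The word moves [Pt2] to [Pt3]. It is the conjugator [w1] of the identity among the first two
    relators. *)
Lemma YxYX_neq1 : gcl presX (winv gy ++ gx ++ winv gy ++ winv gx) <> 1%g.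
Proof.
by move/(congr1 (fun h => (actX h (0, (1%g, Pt2), 0)).1.2.2)); rewrite actX1 actX_gcl.
Qed.

(** * The free subgroup generated by c and d *)

Definition stepF (t : bool) (l : bool * bool) (p : freegrp bool * int) : freegrp bool * int :=
  let g := cls _ (gen l.1) : freegrp bool in
  if l.2 then ((p.1 * g)%g, p.2 + ((l.1 == t) && (p.1 == 1%g))%:R)
  else ((p.1 * g^-1)%g, p.2 - ((l.1 == t) && ((p.1 * g^-1)%g == 1%g))%:R).

Lemma stepFK t l : cancel (stepF t l) (stepF t (linv l)).
Proof.
by move=> [k n]; case: l => b [] /=; rewrite /stepF /= ?mulgK ?mulgVK ?addrK ?subrK.
Qed.

(** Counts signed crossings of the edge from [1] to the generator [t] along a word for [k];
    invertibility of the steps makes the count independent of the word. *)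
Definition potF t (k : freegrp bool) : int := (pact (stepF t) k (1%g, 0)).2.

Lemma pactF1 t (k : freegrp bool) : (pact (stepF t) k (1%g, 0)).1 = k.
Proof.
rewrite -[in RHS](repK k) /pact; elim/last_ind: (rep k) => [//|w l ih].
rewrite -cats1 wact_cat -clsM /= -{}ih /stepF.
by case: l => b [] //=; rewrite -[[:: (b, false)]]/(winv (gen b)) -clsV.
Qed.

Lemma potF_gen t b (k : freegrp bool) :
  potF t (k * cls _ (gen b))%g = potF t k + ((b == t) && (k == 1%g))%:R.
Proof.
have nofalse r p : False -> wact (stepF t) r p = p by [].
by rewrite /potF (pactM (@stepFK t) nofalse) (pact_cls (@stepFK t) nofalse) /= pactF1.
Qed.

Definition cdw (w : word bool) : word 'I_8 :=
  [seq (if l.1 then i8 4 else i8 5, l.2) | l <- w].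

Lemma cdw_eq u v : word_eq (fun=> False) u v -> word_eq (is_relator presX) (cdw u) (cdw v).
Proof.
elim=> {u v} [u|u v _|u v w _ h1 _ h2|u l v|//].
- exact: word_eq_refl.
- exact: word_eq_sym.
- exact: word_eq_trans h1 h2.
- rewrite /cdw !map_cat /=; exact: word_eq_cancel.
Qed.

Definition cdmap (k : freegrp bool) : piX := gcl presX (cdw (rep k)).

Lemma cdmap_cls w : cdmap (cls _ w) = gcl presX (cdw w).
Proof. by apply/clsP/cdw_eq/rep_cls. Qed.

Lemma cdmapM k l : cdmap (k * l)%g = (cdmap k * cdmap l)%g.
Proof. by rewrite -(repK k) -(repK l) clsM !cdmap_cls /cdw map_cat gcl_cat. Qed.

(** Meant to be equivariant for right multiplication by [c] and [d], not a homomorphism; this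
    suffices to invert [cdmap] on its image. *)
Definition cd_coord (h : piX) : freegrp bool := (actX h (0, (1%g, Pt0), 0)).1.2.1.

Definition cd_gen (b : bool) : word 'I_8 := if b then gc else gd.

Lemma cd_coordM h b : cd_coord (h * gcl presX (cd_gen b))%g =
  (cd_coord h * cls _ (gen b))%g.
Proof.
by rewrite /cd_coord actXM actX_gcl; case: (actX h _) => [[r t] s]; case: b.
Qed.

Lemma cd_coord1 : cd_coord 1%g = 1%g.
Proof. by rewrite /cd_coord actX1. Qed.

(* A jump function for the edge [1 -- gcl (cd_gen t)] of the Cayley graph: it is
   supported on the subgroup generated by [c] and [d], which is free, since
   [cd_coord] inverts [cdmap]. *)
Definition potX t (h : piX) : int :=
  if cdmap (cd_coord h) == h then potF t (cd_coord h) else 0.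

Lemma cdmap_gen b : cdmap (cls _ (gen b)) = gcl presX (cd_gen b).
Proof. by rewrite cdmap_cls; case: b. Qed.

Lemma cdmap1 : cdmap 1%g = 1%g.
Proof. exact: (cdmap_cls [::]). Qed.

Lemma potX_gen t b h : potX t (h * gcl presX (cd_gen b))%g =
  potX t h + ((b == t) && (h == 1%g))%:R.
Proof.
rewrite /potX cd_coordM cdmapM cdmap_gen (inj_eq (mulIg _)) potF_gen.
case: eqP => [hE|hN].
  congr (_ + (_ && _)%:R); apply/eqP/eqP => [h1|->]; last exact: cd_coord1.
  by rewrite -hE h1 cdmap1.
(* Off the subgroup both potentials are zero, and no jump occurs there because [1] lies in the
   subgroup. *)
rewrite add0r; case: (h =P 1%g) => [h1|_]; last by rewrite andbF.
by case: hN; rewrite h1 cd_coord1 cdmap1.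
Qed.

(** [potX true] jumps along [c] and is invariant under [d], so it detects [a]; [potX false] detects
    [b] in the same way. *)
Lemma cd_free (a b : grpring piX) :
  a * (1 - wdelta presX gc) + b * (1 - wdelta presX gd) = 0 -> a = 0 /\ b = 0.
Proof.
move=> ab0; split.
  by apply: (mul_sub1_eq0 (f := potX true) _ _ ab0) => h;
    rewrite (potX_gen true true) || rewrite (potX_gen true false) addr0.
have ba0 := etrans (addrC _ _) ab0.
by apply: (mul_sub1_eq0 (f := potX false) _ _ ba0) => h;
  rewrite (potX_gen false false) || rewrite (potX_gen false true) addr0.
Qed.

End ActionX.

(** * Spherical classes of K(X) *)

Lemma d2_presX (c : C2 presX) g : d2 c g = colX (wdelta presX) c g.
Proof. exact: d2E. Qed.

Lemma wdelta_presX : let e := wdelta presX in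
  [/\ e ga * e gc = e gc * e ga, e ga * e gd = e gd * e ga,
    e gb * e gc = e gc * e gb & e gb * e gd = e gd * e gb].
Proof.
have com u v : gcl presX (wcomm u v) = 1%g ->
    wdelta presX u * wdelta presX v = wdelta presX v * wdelta presX u.
  by rewrite gcl_wcomm => /mulgV_comm uv; apply: delta_comm.
split; apply: com.
- exact: (@gcl_relator _ presX (i8 2)).
- exact: (@gcl_relator _ presX (i8 3)).
- exact: (@gcl_relator _ presX (i8 4)).
- exact: (@gcl_relator _ presX (i8 5)).
Qed.

Lemma mulr_unit_eq0 (A : nzRingType) (a u v w : A) :
  u * v = 1 -> (forall b, b * w = 0 -> b = 0) -> a * (u * w) = 0 -> a = 0.
Proof.
move=> uv wreg; rewrite mulrA => /wreg au.
by rewrite -[a]mulr1 -uv mulrA au mul0r.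
Qed.

Lemma ord8_ge2 (Q : 'I_8 -> Prop) (i : 'I_8) : Q (i8 2) -> Q (i8 3) -> Q (i8 4) -> Q (i8 5) ->
  Q (i8 6) -> Q (i8 7) -> (2 <= i)%N -> Q i.
Proof.
by case: i => -[|[|[|[|[|[|[|[|k]]]]]]]] hi // *; rewrite (bool_irrelevance hi isT).
Qed.

Lemma spherical_presX (z : pi2 presX) (i : 'I_8) : (2 <= i)%N -> spherical z i = 0.
Proof.
have [ac ad bc bd] := wdelta_presX.
have hn := @wdelta_nil _ presX; have hc := @wdelta_cat _ presX.
have he := @wdelta_eq _ presX.
have colz g : colX (wdelta presX) (spherical z) g = 0.
  by rewrite -d2_presX d2_pi2 ffunE.
have reg u v : (forall n, (gcl presX (u ++ v) ^+ n.+1)%g != 1%g) ->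
    forall b, b * (wdelta presX u * wdelta presX v - 1) = 0 -> b = 0.
  move=> uv b; have <- := hc u v; exact: mul_delta_sub1_eq0.
have q6 : spherical z (i8 6) = 0.
  apply: (mulr_unit_eq0 (e_Vmul hn hc he gtau) (reg gx (wcomm ga gb) (xab_infinite_order rat))).
  exact: etrans (esym (colX_tau hn hc he (spherical z))) (colz (i8 6)).
have q7 : spherical z (i8 7) = 0.
  apply: (mulr_unit_eq0 (e_Vmul hn hc he gsig) (reg gy (wcomm ga gb) (yab_infinite_order rat))).
  exact: etrans (esym (colX_sig hn hc he (spherical z))) (colz (i8 7)).
(* With the last two coordinates gone, the columns of [a] and [b] are relations between [1 - c] and
   [1 - d]. *)
have [q2 q3] := cd_free rat (etrans (esym (colX_a0 hn hc he ac ad bc bd q6 q7)) (colz (i8 2))).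
have [q4 q5] := cd_free rat (etrans (esym (colX_b0 hn hc he ac ad bc bd q6 q7)) (colz (i8 3))).
exact: (@ord8_ge2 (fun i => spherical z i = 0)).
Qed.

(** The integer matrix with rows [(1, 2)], [(2, 3)] has determinant [-1]; its entries are central,
    so elimination works over any ring. *)
Lemma unimodular_eq0 (A : nzRingType) (p q r s : A) : r = 0 -> s = 0 ->
  p + q * 2 + r = 0 -> p * 2 + q * 3 + s = 0 -> p = 0 /\ q = 0.
Proof.
move=> -> ->; rewrite !addr0 => /eqP; rewrite addr_eq0 => /eqP->.
rewrite mulNr -mulrA -natrM -mulrN -mulrDr (_ : - (2 * 2)%:R + 3 = -1 :> A); last first.
  by rewrite (natrD _ 3 1) opprD addrAC addNr add0r.
by rewrite mulrN mulr1 => /eqP; rewrite oppr_eq0 => /eqP->; rewrite mul0r oppr0.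
Qed.

(** The coordinates from 2 on vanish before the inclusion; afterwards the columns of [x] and [y]
    form a unimodular system for the other two. *)
Lemma pi2_incl_presY (z : pi2 presX) : (pi2_incl relsY z : pi2 presY) = 0.
Proof.
have [[x1 y1 t1 s1] [ab cd ac ad [bc bd]]] := wdelta_presY.
have hn := @wdelta_nil _ presY; have hc := @wdelta_cat _ presY.
have he := @wdelta_eq _ presY.
set z' : pi2 presY := pi2_incl relsY z.
have z'0 (i : 'I_8) : (2 <= i)%N -> spherical z' (inl i) = 0.
  by move=> i2; rewrite ffunE (spherical_presX z i2) raddf0.
have [q0 q1] := unimodular_eq0 (z'0 (i8 6) isT) (z'0 (i8 7) isT)
  (etrans (esym (colY_x hn hc he ac ad bc bd ab cd x1 y1 t1 s1 _))
    (@colX_spherical_presY z' (i8 0) isT))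
  (etrans (esym (colY_y hn hc he ac ad bc bd ab cd x1 y1 t1 s1 _))
    (@colX_spherical_presY z' (i8 1) isT)).
apply/val_inj/ffunP => -[i|j]; last by rewrite ffunE [RHS]ffunE.
rewrite [RHS]ffunE.
case: i => -[|[|k]] hi; [| |exact: z'0];
  rewrite (bool_irrelevance hi isT); [exact: q0|exact: q1].
Qed.

(** * An identity among the first two relators *)

Fixpoint reduce (X : eqType) (w : word X) : word X :=
  if w is l :: w' then
    let v := reduce w' in
    if v is l' :: v' then if l' == linv l then v' else l :: v else [:: l]
  else [::].

Section IdentitySequence.
Variables (R : word 'I_8 -> Prop) (A : nzRingType) (e : word 'I_8 -> A).
Hypothesis e_nil : e [::] = 1.
Hypothesis e_cat : forall u v, e (u ++ v) = e u * e v.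
Hypothesis e_eq : forall u v, word_eq R u v -> e u = e v.

(** A cancelling pair has derivative zero and value [1]. This turns a computed free reduction into
    an identity of derivatives. *)
Lemma efox_reduce g w : efox e g (reduce w) = efox e g w.
Proof.
elim: w => [//|l w ih] /=; rewrite -[l :: w]cat1s (efox_cat e_nil e_cat) -{}ih.
rewrite -(efox_cat e_nil e_cat) /=; case: (reduce w) => [//|l' v].
case: eqP => [->|//]; rewrite -[[:: l, _ & v]]/([:: l; linv l] ++ v).
rewrite (efox_cat e_nil e_cat) -[[:: l; linv l]]/([:: l] ++ winv [:: l]).
rewrite (efox_cat e_nil e_cat) (efox_winv e_nil e_cat e_eq) mulrN mulrA e_cat.
by rewrite (e_mulV e_nil e_cat e_eq [:: l]) !mul1r subrr add0r.
Qed.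

Lemma efox_conj g w r : e r = 1 -> efox e g (w ++ r ++ winv w) = e w * efox e g r.
Proof.
move=> r1; rewrite !(efox_cat e_nil e_cat) (efox_winv e_nil e_cat e_eq) r1 mul1r.
by rewrite mulrDr mulrN mulrA (e_mulV e_nil e_cat e_eq) mul1r addrCA subrr addr0.
Qed.

Lemma e_conj w r : e r = 1 -> e (w ++ r ++ winv w) = 1.
Proof. by move=> r1; rewrite !e_cat r1 mul1r (e_mulV e_nil e_cat e_eq). Qed.

Lemma e_winv1 r : e r = 1 -> e (winv r) = 1.
Proof. by move=> r1; rewrite -[LHS]mul1r -{1}r1 (e_mulV e_nil e_cat e_eq). Qed.

Lemma efox_winv1 g r : e r = 1 -> efox e g (winv r) = - efox e g r.
Proof. by move=> r1; rewrite (efox_winv e_nil e_cat e_eq) e_winv1 // mul1r. Qed.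

Lemma efox_cat4 g u v w t : efox e g (u ++ v ++ w ++ t) =
  efox e g u + e u * (efox e g v + e v * (efox e g w + e w * efox e g t)).
Proof. by rewrite !(efox_cat e_nil e_cat). Qed.

Let rA := gx ++ gx ++ gy ++ winv gx ++ gy.
Let rB := gx ++ gy ++ gy ++ gy ++ gy ++ gx ++ winv gy.
Let w1 := winv gy ++ gx ++ winv gy ++ winv gx.
Let w2 := winv gy ++ gx ++ winv gy.
Let w3 := gx ++ winv gy.
Hypotheses (rA1 : e rA = 1) (rB1 : e rB = 1).

(* The product [rA . w1 rA^-1 w1^-1 . w2 rB w2^-1 . w3 rB^-1 w3^-1] is freely
   trivial; these are the coefficients of its Fox derivatives. *)
Definition idseq (i : 'I_8) : A := nth 0 [:: 1 - e w1; e w2 - e w3] i.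

Lemma idseq_cycle g : colX e idseq g = 0.
Proof.
rewrite colXE /idseq /= !mul0r !addr0.
have := efox_reduce g (rA ++ (w1 ++ winv rA ++ winv w1) ++
  (w2 ++ rB ++ winv w2) ++ (w3 ++ winv rB ++ winv w3)).
rewrite (_ : reduce _ = [::]); last by vm_compute.
(* Every factor evaluates to [1], so the derivative of the product is the sum of those of the
   factors. *)
rewrite efox_cat4 rA1 (e_conj w1 (e_winv1 rA1)) (e_conj w2 rB1) !mul1r.
rewrite (efox_conj g w1 (e_winv1 rA1)) (efox_conj g w2 rB1) (efox_conj g w3 (e_winv1 rB1)).
rewrite (efox_winv1 g rA1) (efox_winv1 g rB1).
by rewrite {1}/efox !mulrN !mulrBl mul1r => ->; rewrite !addrA.
Qed.

End IdentitySequence.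

Lemma delta_eq1 (G : groupType) (g : G) : delta g = 1 -> g = 1%g.
Proof.
move/(congr1 (zlift (fun h => (h == 1%g)%:R : int))).
by rewrite zlift_delta (zlift_delta _ 1%g) eqxx; case: eqP.
Qed.

Lemma presX_not_aspherical : ~ aspherical presX.
Proof.
pose c : C2 presX := [ffun i => idseq (wdelta presX) i].
have c_cycle : c \in @is_cycle2 _ presX.
  apply/eqP/ffunP => g; rewrite d2_presX [RHS]ffunE.
  have rel1 i : wdelta presX (relator presX i) = 1.
    by rewrite /wdelta gcl_relator.
  apply: etrans (idseq_cycle (@wdelta_nil _ presX) (@wdelta_cat _ presX)
    (@wdelta_eq _ presX) (rel1 (i8 0)) (rel1 (i8 1)) g).
  by apply: eq_bigr => i _; apply: (congr2 _ (ffunE _ _)) (erefl _).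
(* The first coordinate is [1 - w1], which vanishes only if [y^-1 x y^-1 x^-1] is trivial in the
   group. *)
move=> /(_ (Pi2 c_cycle)) /(congr1 (fun z : pi2 presX => (spherical z : C2 presX) (i8 0))).
rewrite /= ffunE [RHS]ffunE => /subr0_eq w1E.
exact/(YxYX_neq1 rat)/delta_eq1/esym.
Qed.

Theorem theorem1p1 :
  [/\ (* (i) *)
      ~ aspherical presX,
      (* (ii) *)
      ~ aspherical presY /\ cockcroft presY,
      (* (iii) *)
      (forall z : pi2 presX, (pi2_incl relsY z : pi2 presY) = 0) /\
      (forall z : pi2 presY, (pi2_incl relsZ z : pi2 presZ) = 0)
    & (* (iv) *)
      identity_property presX relsY].
Proof.
split; last exact: identity_property_presY.
- exact: presX_not_aspherical.
- by split; [exact: presY_not_aspherical|exact: cockcroft_presY].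
by split; [exact: pi2_incl_presY|exact: pi2_incl_presZ].
Qed.
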